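(* Let $q\ge1$, $p=p_{\mathrm{sd}}(q)$, and let $\gamma$ be a contour in $\mathbb Z^2$. With $E_i=\mathbf E(\mathrm{int}(\gamma))$, $G$ and $G^w$ as below and $\bar1$ the configuration identically equal to $1$, $$\mathbb P^{G^w,E_i,\bar1}(\gamma\text{ is a }q\text{-contour})\le\big(4q^{-1/8}\big)^{|\gamma|}q^{1/2}.$$
   Context: $p_{\mathrm{sd}}(q)\in(0,1)$ solves $(p/(1-p))^4=q$. Dual lattice: $(\mathbb Z^2)^*=\mathbb Z^2+(\tfrac12,\tfrac12)$. For a directed nearest-neighbour bond $\vec e=(x,y)$ of $\mathbb Z^2$, its dual is the directed bond $\vec e^{\,*}=\big(\tfrac12(x+y+(x-y)^\perp),\tfrac12(x+y+(y-x)^\perp)\big)$ of $(\mathbb Z^2)^*$, where $\perp$ is counter-clockwise rotation by $90^\circ$. A closed path $\gamma=(x_1^*,\dots,x_n^*,x_1^* )$ in $(\mathbb Z^2)^*$ along pairwise distinct directed dual bonds $\vec b_i^{\,*}=(x_i^*,x_{i+1}^* )$ (indices mod $n$) determines primal directed bonds $\vec b_i=(z_i,y_i)$ with duals $\vec b_i^{\,*}$; $\mathbf E(\gamma)$ is the set of undirected primal bonds $b_i$, $\mathbf V(\gamma)^*=\{x_i^*\}$, $|\gamma|=n$. $\gamma$ is a contour if the graph $(\mathbb Z^2,\mathbf E(\mathbb Z^2)\setminus\mathbf E(\gamma))$ has a bounded connected component $\mathrm{int}(\gamma)$ whose set of vertices having a $\mathbb Z^2$-neighbour outside $\mathrm{int}(\gamma)$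 equals $\{z_1,\dots,z_n\}$. For $x^*\in(\mathbb Z^2)^*$ the plaquette with centre $x^*$ is the unit square whose corners are the four points of $\mathbb Z^2$ at distance $\sqrt2/2$ from $x^*$; its faces are its four sides (bonds of $\mathbb Z^2$). $\mathbf E(\mathrm{int}(\gamma))$ is the set of bonds with both endpoints in $\mathrm{int}(\gamma)$. $\gamma$ is a $q$-contour for $\kappa$ if $\kappa_b=1$ for all $b\in\mathbf E(\gamma)$, and for every plaquette with centre in $\mathbf V(\gamma)^*$ every face $b$ of it with $b\in\mathbf E(\mathrm{int}(\gamma))$ has $\kappa_b=q$. $G$ is the graph with edge set $E=E_i\cup\mathbf E(\gamma)$ and the endpoints of these edges as vertices; $G^w$ is obtained from $G$ by identifying all vertices of $G$ not in $\mathrm{int}(\gamma)$ into a single vertex (edges still indexed by $E$). For a finite connected multigraph $H$ and conductances $c$, $\Delta^H_cf(x)=\sum_{e=\{x,y\}}c_e(f(x)-f(y))$ acting on zero-sum functions on $\mathbf V(H)$, determinant $\det\Delta^H_c$. For $E''\subset\mathbf E(H)$ and $\lambda\in\{1,q\}^{\mathbf E(H)}$, $\mathbb P^{H,E'',\lambda}$ is the measure on $\kappa\in\{1,q\}^{E''}$ with $\mathbb P^{H,E'',\lambda}(\kappa)\propto p^{h(\kappa)}(1-p)^{s(\kappa)}(\det\Delta^H_{(\lambda,\kappa)})^{-1/2}$, where $h,s$ count edges of $E''$ with $\kappa_e=q$ resp. $1$, and $(\lambda,\kappa)$ equals $\kappa$ on $E''$ and $\lambda$ elsewhere. The event ''$\gamma$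 is a $q$-contour'' is evaluated for the configuration $(\bar1,\kappa)$. *)

(* Defs.v *)
From HB Require Import structures.
From mathcomp Require Import all_boot all_order all_algebra.
Unset Printing Implicit Defensive.
Import Order.TTheory GRing.Theory Num.Theory.
Local Open Scope ring_scope.

(* A primal point (x1,x2) of Z^2 is the pair of integers (x1,x2).
   A dual point (a1 + 1/2, a2 + 1/2) of (Z^2)^* is encoded by the pair (a1,a2). *)
Definition pt := (int * int)%type.

Definition padd (x y : pt) : pt := (x.1 + y.1, x.2 + y.2).
Definition psub (x y : pt) : pt := (x.1 - y.1, x.2 - y.2).
Definition perp (x : pt) : pt := (- x.2, x.1).

(* nearest neighbours (also used for dual points, since the encoding is a shift) *)
Definition nn (x y : pt) : bool := `|x.1 - y.1| + `|x.2 - y.2| == 1 :> int.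

(* doubled coordinates: a primal point x is 2x, a dual point (a1,a2) is
   (2 a1 + 1, 2 a2 + 1), i.e. twice (a1+1/2, a2+1/2). *)
Definition dbl_dual (a : pt) : pt := (2 * a.1 + 1, 2 * a.2 + 1).

(* The dual of the directed primal bond (x,y), in doubled coordinates:
   2 * ( 1/2 (x+y+(x-y)^perp) , 1/2 (x+y+(y-x)^perp) ). *)
Definition dual_dbond (x y : pt) : pt * pt :=
  (padd (padd x y) (perp (psub x y)), padd (padd x y) (perp (psub y x))).

(* (v, true) is the bond {v, v+(1,0)}; (v, false) is the bond {v, v+(0,1)}. *)
Definition bond := (pt * bool)%type.
Definition bsrc (b : bond) : pt := b.1.
Definition btgt (b : bond) : pt := padd b.1 (if b.2 then (1, 0) else (0, 1)).

Definition ubond (x y : pt) : bond :=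
  if x.1 < y.1 then (x, true) else if y.1 < x.1 then (y, true)
  else if x.2 < y.2 then (x, false) else (y, false).

Definition pt0 : pt := (0, 0).
Definition bond0 : bond := (pt0, true).

(* gamma = (x_1,...,x_n,x_1) given by g = [:: x_1; ...; x_n]; x_{i+1} with indices mod n *)
Definition cnext (g : seq pt) (i : nat) : pt := nth pt0 g (i.+1 %% size g).

Definition dual_closed_path (g : seq pt) : Prop :=
  (0 < size g)%N /\
  (forall i, (i < size g)%N -> nn (nth pt0 g i) (cnext g i)) /\
  uniq [seq (nth pt0 g i, cnext g i) | i <- iota 0 (size g)].

Definition primal_bonds (g zs ys : seq pt) : Prop :=
  size zs = size g /\ size ys = size g /\
  forall i, (i < size g)%N ->
    nn (nth pt0 zs i) (nth pt0 ys i) /\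
    dual_dbond (nth pt0 zs i) (nth pt0 ys i) = (dbl_dual (nth pt0 g i), dbl_dual (cnext g i)).

Definition Egamma (zs ys : seq pt) : seq bond :=
  undup [seq ubond zy.1 zy.2 | zy <- zip zs ys].

Definition open_adj (Eg : seq bond) : rel pt :=
  fun x y => nn x y && (ubond x y \notin Eg).

Definition connected (e : rel pt) (x y : pt) : Prop :=
  exists s : seq pt, path e x s /\ last x s = y.

(* I (a finite, hence bounded, duplicate-free list of vertices) is a connected
   component of (Z^2, E(Z^2)\E(gamma)) whose inner vertex boundary is {z_1..z_n}. *)
Definition is_interior (zs ys I : seq pt) : Prop :=
  uniq I /\ (0 < size I)%N /\
  (forall x y, x \in I -> (y \in I <-> connected (open_adj (Egamma zs ys)) x y)) /\
  (forall v, (v \in I /\ exists w, nn v w /\ w \notin I) <-> v \in zs).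

Definition Eint (I : seq pt) : seq bond :=
  [seq b <- [seq (v, true) | v <- I] ++ [seq (v, false) | v <- I] | btgt b \in I].

Definition EG (zs ys I : seq pt) : seq bond := undup (Eint I ++ Egamma zs ys).

Section Lap.
Context {R : comNzRingType} {V B : eqType}.

Definition lap_entry (es : seq B) (ends : B -> V * V) (c : B -> R) (u w : V) : R :=
  \sum_(b <- es) c b * (((u == (ends b).1)%:R - (u == (ends b).2)%:R)
                       * ((w == (ends b).1)%:R - (w == (ends b).2)%:R)).

(* det of Delta_c acting on zero-sum functions on the vertex list vs
   = [:: v_0; ...; v_m]: matrix of this linear map in the basis
   (delta_{v_j} - delta_{v_0})_{j=1..m} of the zero-sum functions. *)
Definition det_zero_sum (vs : seq V) (v0 : V) (es : seq B) (ends : B -> V * V)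
    (c : B -> R) : R :=
  \det (\matrix_(k < (size vs).-1, j < (size vs).-1)
          (lap_entry es ends c (nth v0 vs k.+1) (nth v0 vs j.+1)
           - lap_entry es ends c (nth v0 vs k.+1) (nth v0 vs 0))).
End Lap.

(* vertices of G^w: Some v for v in int(gamma), None for the identified vertex *)
Definition wv (I : seq pt) (v : pt) : option pt := if v \in I then Some v else None.
Definition wends (I : seq pt) (b : bond) : option pt * option pt := (wv I (bsrc b), wv I (btgt b)).
Definition Gw_vertices (zs ys I : seq pt) : seq (option pt) :=
  undup (flatten [seq [:: (wends I b).1; (wends I b).2] | b <- EG zs ys I]).

Definition det_Gw {R : comNzRingType} (zs ys I : seq pt) (c : bond -> R) : R :=
  det_zero_sum (Gw_vertices zs ys I) None (EG zs ys I) (wends I) c.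

Section Meas.
Context {R : rcfType}.

Definition conf (q : R) (Epp : seq bond) (lam : bond -> R)
    (kap : {ffun 'I_(size Epp) -> bool}) (b : bond) : R :=
  if [exists i : 'I_(size Epp), (nth bond0 Epp i == b) && kap i] then q
  else if [exists i : 'I_(size Epp), nth bond0 Epp i == b] then 1
  else lam b.

Definition weight (p q : R) (Epp : seq bond) (lam : bond -> R) (detf : (bond -> R) -> R)
    (kap : {ffun 'I_(size Epp) -> bool}) : R :=
  let h := #|[pred i | kap i]| in
  let s := (size Epp - h)%N in
  p ^+ h * (1 - p) ^+ s * (Num.sqrt (detf (conf q Epp lam kap)))^-1.

(* P^{H,E'',lambda}(A), for an event A on the configuration (lambda,kappa);
   detf c = det Delta^H_c *)
Definition Pmeas (p q : R) (Epp : seq bond) (lam : bond -> R) (detf : (bond -> R) -> R)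
    (A : (bond -> R) -> bool) : R :=
  (\sum_(kap : {ffun 'I_(size Epp) -> bool} | A (conf q Epp lam kap)) weight p q Epp lam detf kap)
  / (\sum_(kap : {ffun 'I_(size Epp) -> bool}) weight p q Epp lam detf kap).

Definition plaq_faces (a : pt) : seq bond :=
  [:: (a, true); ((a.1, a.2 + 1), true); (a, false); ((a.1 + 1, a.2), false)].

Definition is_qcontour (q : R) (g zs ys I : seq pt) (c : bond -> R) : bool :=
  all (fun b => c b == 1) (Egamma zs ys) &&
  all (fun a => all (fun b => (b \in Eint I) ==> (c b == q)) (plaq_faces a)) g.
End Meas.

(* Main.v *)
Require Import Defs.
From HB Require Import structures.
From mathcomp Require Import all_boot all_order all_algebra.
From mathcomp Require Import perm ring zify.
Import Order.TTheory GRing.Theory Num.Theory.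
Local Open Scope ring_scope.

(* Write [kap] for a configuration for which gamma is a q-contour. Then E(gamma) is exactly
   the edge boundary of int(gamma). The determinant of [kap] on G^w is at least the one on
   int(gamma) with free boundary conditions, which planar duality turns into the determinant
   of q/kap on the dual graph with wired boundary conditions. The inner vertices of that dual
   graph are the plaquettes with all corners in int(gamma); moving every plaquette to its
   lower left corner embeds them into int(gamma), and q/kap, extended by 1, becomes a new
   configuration there. The interior vertices that are not hit have only conductances 1
   around them and number at most |gamma|, so that Fischer's inequality bounds the
   determinant of the new configuration on G^w by 4^|gamma| times the dual one. The map
   between configurations is injective, and collecting powers of q with Euler's formula and
   the handshake identity for int(gamma) shows that at p = p_sd the weight of [kap] is at
   most (2 q^(-1/8))^|gamma| q^(1/2) times that of its image. *)

Set Implicit Arguments.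
Unset Strict Implicit.

(** * Schur complements and positive definite matrices *)

Lemma det_schur {F : fieldType} n1 n2 (d : 'M[F]_n1) (u : 'M_(n1, n2))
    (v : 'M_(n2, n1)) (M : 'M_n2) :
  M \in unitmx ->
  \det (block_mx d u v M) = \det (d - u *m invmx M *m v) * \det M.
Proof.
move=> uM.
have -> : block_mx d u v M =
    block_mx 1%:M (u *m invmx M) 0 1%:M *m block_mx (d - u *m invmx M *m v) 0 v M.
  by rewrite mulmx_block !mul1mx !mul0mx !add0r -[u *m _ *m M]mulmxA mulVmx //
    mulmx1 subrK.
by rewrite det_mulmx det_ublock !det1 !mul1r det_lblock.
Qed.

Section PositiveDefinite.
Context {R : realFieldType}.

Definition qform n (X : 'M[R]_n) (x : 'rV_n) : R := (x *m X *m x^T) 0 0.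

Definition posdef n (X : 'M[R]_n) : Prop :=
  X^T = X /\ forall x : 'rV_n, x != 0 -> 0 < qform X x.

Lemma posdef_ge0 n (X : 'M[R]_n) x : posdef X -> 0 <= qform X x.
Proof.
move=> [_ pX]; have [->|/pX/ltW//] := eqVneq x 0.
by rewrite /qform !mul0mx mxE.
Qed.

Lemma posdef_unit n (X : 'M[R]_n) : posdef X -> X \in unitmx.
Proof.
move=> [_ pX]; rewrite -row_free_unit -kermx_eq0; apply/eqP/row_matrixP => i.
rewrite row0; apply/eqP; apply/negPn/negP => nz; have := pX _ nz.
by rewrite /qform -row_mul mulmx_ker row0 mul0mx mxE ltxx.
Qed.

Lemma qform_dr n (X : 'M[R]_(1 + n)) x : qform X (row_mx 0 x) = qform (drsubmx X) x.
Proof.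
rewrite /qform -[in LHS](submxK X) tr_row_mx mul_row_block mul_row_col.
by rewrite !mul0mx trmx0 mulmx0 !add0r.
Qed.

Lemma posdef_dr n (X : 'M[R]_(1 + n)) : posdef X -> posdef (drsubmx X).
Proof.
move=> [sX pX]; split; first by rewrite trmx_drsub sX.
move=> x nx; rewrite -qform_dr; apply: pX.
by apply: contra_neq nx => /eqP; rewrite row_mx_eq0 => /andP[_ /eqP].
Qed.

(* The Schur complement is the minimum of the quadratic form over the vectors whose first
   coordinate is 1. *)
Lemma det_posdef_min n (X : 'M[R]_(1 + n)) :
  X^T = X -> posdef (drsubmx X) ->
  exists y : 'rV_n,
    \det X = qform X (row_mx 1%:M y) * \det (drsubmx X) /\
    forall z, qform X (row_mx 1%:M y) <= qform X (row_mx 1%:M z).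
Proof.
move=> sX pM; have uM := posdef_unit pM.
set M := drsubmx X in pM uM *; set u := ursubmx X.
set d := ulsubmx X.
have eX : X = block_mx d u u^T M by rewrite -[LHS]submxK /d /u /M trmx_ursub sX.
pose y := - (u *m invmx M).
have yX : row_mx 1%:M y *m X = row_mx (d - u *m invmx M *m u^T) 0.
  by rewrite eX mul_row_block !mul1mx /y !mulNmx -[_ *m M]mulmxA mulVmx // mulmx1 subrr.
have fz z : qform X (row_mx 1%:M z) =
    (d - u *m invmx M *m u^T) 0 0 + qform M (z - y).
  have -> : row_mx 1%:M z = row_mx 1%:M y + row_mx 0 (z - y) :> 'rV_(1 + n).
    by rewrite add_row_mx addr0 addrC subrK.
  rewrite -qform_dr /qform mulmxDl linearD /= mulmxDl !mulmxDr yX.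
  rewrite !tr_row_mx !mul_row_col !trmx0 !mul0mx !mulmx0 !trmx1 !mulmx1 !addr0.
  rewrite [LHS]mxE; congr (_ + _).
  suff -> : row_mx 0 (z - y) *m X *m col_mx 1%:M y^T = 0 by rewrite add0r.
  by rewrite -[in LHS]sX -trmx1 -tr_row_mx -mulmxA -trmx_mul yX tr_row_mx trmx0
    mul_row_col mul0mx mulmx0 addr0.
exists y; have fy := fz y; rewrite subrr in fy.
have q0 : qform M 0 = 0 by rewrite /qform !mul0mx mxE.
split; last by move=> z; rewrite fy fz q0 lerD2l posdef_ge0.
rewrite fy q0 addr0 {1}eX det_schur //; congr (_ * _).
by rewrite det_mx11.
Qed.

Lemma posdef_det_gt0 n (X : 'M[R]_n) : posdef X -> 0 < \det X.
Proof.
elim: n X => [|n IH] X pX; first by rewrite det_mx00.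
have [y [-> _]] := @det_posdef_min n X pX.1 (posdef_dr pX).
apply: mulr_gt0; last exact/IH/posdef_dr.
apply: pX.2; apply/eqP => /(congr1 (@lsubmx _ 1 1 n)).
by rewrite row_mxKl => /matrixP/(_ 0 0); rewrite !mxE /= => /eqP; rewrite oner_eq0.
Qed.

(** Induction on the dimension: the Schur complement, being a minimum of the form, is monotone in
    the form, and the remaining block is the form restricted to vectors with first coordinate 0. *)
Lemma det_posdef_le n (X Y : 'M[R]_n) :
  posdef X -> posdef Y -> (forall x, qform X x <= qform Y x) -> \det X <= \det Y.
Proof.
elim: n X Y => [|n IH] X Y pX pY leXY; first by rewrite !det_mx00.
have [y [eX minX]] := @det_posdef_min n X pX.1 (posdef_dr pX).
have [z [eY minY]] := @det_posdef_min n Y pY.1 (posdef_dr pY).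
rewrite eX eY; apply: ler_pM.
- exact: posdef_ge0.
- exact/ltW/posdef_det_gt0/posdef_dr.
- exact: le_trans (minX z) (leXY _).
- apply: IH; [exact: posdef_dr|exact: posdef_dr|].
  by move=> x; rewrite -!qform_dr.
Qed.

Lemma posdef_gram m n (A : 'M[R]_(n, m)) (d : 'rV[R]_m) :
  (forall i, 0 < d 0 i) -> (forall x : 'rV_n, x *m A = 0 -> x = 0) ->
  posdef (A *m diag_mx d *m A^T).
Proof.
move=> d0 injA; split.
  by rewrite !trmx_mul trmxK tr_diag_mx mulmxA.
move=> x nx; have -> : qform (A *m diag_mx d *m A^T) x =
    \sum_j d 0 j * (x *m A) 0 j ^+ 2.
  rewrite /qform !mulmxA -mulmxA -trmx_mul mxE; apply: eq_bigr => j _.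
  by rewrite mul_mx_diag !mxE; ring.
have ge0 j : 0 <= d 0 j * (x *m A) 0 j ^+ 2 by rewrite mulr_ge0 ?sqr_ge0 // ltW.
rewrite lt_def sumr_ge0 // andbT; apply: contra_neq nx => /eqP.
rewrite psumr_eq0 // => /allP h; apply: injA; apply/matrixP => i j.
rewrite (ord1 i) [RHS]mxE; have := h j (mem_index_enum _).
by rewrite mulf_eq0 gt_eqF //= sqrf_eq0 => /eqP.
Qed.

End PositiveDefinite.

(** * Complementary minors and exact sequences *)

(* Jacobi's formula for complementary minors of the inverse: [col_mx A S] and
   [row_mx R0 B^T] are mutually inverse integer matrices, so their determinant is 1 or -1. *)
Lemma det_complementary_minors {F : fieldType} r f (A : 'M[int]_(r, r + f)) (B : 'M[int]_(f, r + f))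
    (R0 : 'M[int]_(r + f, r)) (S : 'M[int]_(f, r + f)) (d : 'rV[F]_(r + f)) :
  A *m R0 = 1%:M -> A *m B^T = 0 -> S *m R0 = 0 -> S *m B^T = 1%:M ->
  (forall i, d 0 i != 0) ->
  \det (map_mx intr A *m diag_mx d *m (map_mx intr A)^T)
  = \det (diag_mx d) *
    \det (map_mx intr B *m diag_mx (map_mx (fun x => x^-1) d) *m (map_mx intr B)^T).
Proof.
move=> AR AB SR SB d0.
have WU : col_mx A S *m row_mx R0 B^T = 1%:M.
  by rewrite mul_col_row AR AB SR SB -scalar_mx_block.
pose Ar := map_mx intr A : 'M[F]_(_, _); pose Br := map_mx intr B : 'M[F]_(_, _).
pose Sr := map_mx intr S : 'M[F]_(_, _); pose Rr := map_mx intr R0 : 'M[F]_(_, _).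
pose W := col_mx Ar Sr; pose U := row_mx Rr Br^T.
pose D := diag_mx d; pose D' := diag_mx (map_mx (fun x => x^-1) d).
(* [K] links the two minors: [W *m D *m K] and [U^T *m K] are block triangular, each with one
   identity diagonal block and one of the two Gram matrices as the other. *)
pose K := row_mx Ar^T (D' *m Br^T).
have DD' : D *m D' = 1%:M.
  rewrite /D /D' mulmx_diag -[RHS]diag_const_mx; congr diag_mx.
  by apply/matrixP => i j; rewrite !mxE divff.
have ABr : Ar *m Br^T = 0 by rewrite /Ar /Br map_trmx -map_mxM AB map_mx0.
have SBr : Sr *m Br^T = 1%:M by rewrite /Sr /Br map_trmx -map_mxM SB map_mx1.
have ARr : Ar *m Rr = 1%:M by rewrite /Ar /Rr -map_mxM AR map_mx1.
have BAr : Br *m Ar^T = 0 by rewrite -[LHS]trmxK trmx_mul trmxK ABr trmx0.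
have RAr : Rr^T *m Ar^T = 1%:M by rewrite -trmx_mul ARr trmx1.
have e1 : \det (W *m D) * \det K = \det (Ar *m D *m Ar^T).
  rewrite -det_mulmx mul_col_mx mul_col_row.
  rewrite -!mulmxA !(mulmxA D D') DD' !mul1mx ABr SBr det_lblock det1 mulr1.
  by rewrite !mulmxA.
have e2 : \det U * \det K = \det (Br *m D' *m Br^T).
  rewrite -det_tr -det_mulmx tr_row_mx trmxK mul_col_row RAr BAr.
  by rewrite det_ublock det1 mul1r !mulmxA.
have e3 : \det W * \det U = 1.
  rewrite -det_mulmx mul_col_row ARr ABr SBr /Sr /Rr -map_mxM SR map_mx0.
  by rewrite -scalar_mx_block det1.
have e4 : \det W ^+ 2 = 1.
  have -> : \det W = (\det (col_mx A S))%:~R by rewrite -det_map_mx map_col_mx.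
  have : (\det (col_mx A S)) \is a GRing.unit.
    by rewrite -unitmxE; have [] := mulmx1_unit WU.
  by rewrite qualifE => /orP[] /eqP ->; rewrite ?rmorphN1 ?rmorph1 ?sqrrN expr1n.
rewrite -/Ar -/Br -/D -/D' -e1 -e2 det_mulmx.
have -> : \det U = \det W by apply: (mulfI (x := \det W)); rewrite ?e3 -?expr2 ?e4 //;
  apply/eqP => w0; move/eqP: e3; rewrite w0 mul0r eq_sym oner_eq0.
ring.
Qed.

(** The hypotheses say that [B^T] and [A] form a short exact sequence of free abelian groups. Such a
    sequence splits: [R0] is a section of [A] and [S] the matching retraction of [B^T], which are
    the data needed for complementary minors. *)
Lemma det_duality {F : realFieldType} m r f (A : 'M[int]_(r, m)) (B : 'M[int]_(f, m)) :
  (forall i : 'I_r, exists z : 'cV[int]_m, A *m z = delta_mx i 0) ->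
  A *m B^T = 0 ->
  (forall z : 'cV[int]_m, A *m z = 0 -> exists y : 'cV[int]_f, B^T *m y = z) ->
  (forall y : 'cV[int]_f, B^T *m y = 0 -> y = 0) ->
  [/\ (r + f)%N = m,
      forall x : 'rV[F]_r, x *m map_mx intr A = 0 -> x = 0 &
      forall d : 'rV[F]_m, (forall i, d 0 i != 0) ->
        \det (map_mx intr A *m diag_mx d *m (map_mx intr A)^T)
        = \det (diag_mx d) *
          \det (map_mx intr B *m diag_mx (map_mx (fun x => x^-1) d) *m (map_mx intr B)^T)].
Proof.
move=> surjA AB exact_ injB.
have [Rf ARf] := fin_all_exists surjA.
pose R0 : 'M[int]_(m, r) := \matrix_(i, j) Rf j i 0.
have AR : A *m R0 = 1%:M.
  apply/matrixP => i j; have /matrixP/(_ i 0) := ARf j; rewrite !mxE eqxx andbT => <-.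
  by apply: eq_bigr => k _; rewrite !mxE.
have ex j : exists y : 'cV[int]_f, B^T *m y = col j (1%:M - R0 *m A).
  by apply: exact_; rewrite colE mulmxA mulmxBr mulmx1 mulmxA AR mul1mx subrr mul0mx.
have [Sf BSf] := fin_all_exists ex.
pose S : 'M[int]_(f, m) := \matrix_(i, j) Sf j i 0.
have BS : B^T *m S = 1%:M - R0 *m A.
  apply/matrixP => i j; have /matrixP/(_ i 0) := BSf j; rewrite [in RHS]mxE => <-.
  by rewrite !mxE; apply: eq_bigr => k _; rewrite !mxE.
have injBm k (Y : 'M[int]_(f, k)) : B^T *m Y = 0 -> Y = 0.
  move=> h; apply/matrixP => i j; rewrite mxE.
  have /injB/matrixP/(_ i 0) : B^T *m col j Y = 0 by rewrite colE mulmxA h mul0mx.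
  by rewrite !mxE.
have SB : S *m B^T = 1%:M.
  apply/eqP; rewrite -subr_eq0; apply/eqP/injBm.
  by rewrite mulmxBr mulmx1 mulmxA BS mulmxBl mul1mx -mulmxA AB mulmx0 subr0 subrr.
have SR : S *m R0 = 0.
  by apply: injBm; rewrite mulmxA BS mulmxBl mul1mx -mulmxA AR mulmx1 subrr.
have UW : row_mx R0 B^T *m col_mx A S = 1%:M by rewrite mul_row_col BS addrC subrK.
have WU : col_mx A S *m row_mx R0 B^T = 1%:M.
  by rewrite mul_col_row AR AB SR SB -scalar_mx_block.
have e : (r + f)%N = m by apply/eqP; rewrite eqn_leq (mulmx1_min WU) (mulmx1_min UW).
split=> //.
  move=> x xA; rewrite -[x]mulmx1 -(map_mx1 intr) -AR map_mxM mulmxA xA.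
  by rewrite mul0mx.
subst m => d d0.
exact: det_complementary_minors AR AB SR SB d0.
Qed.

(** * Matrices indexed by lists *)

Section SeqMatrix.

(** Keeping the index lists visible turns matrix products into sums over lists of vertices or
    bonds. *)
Definition mxL {R : Type} {S T : Type} (s : seq S) (t : seq T) (F : S -> T -> R) :
    'M[R]_(size s, size t) :=
  \matrix_(i, j) F (tnth (in_tuple s) i) (tnth (in_tuple t) j).

Lemma eq_mxL {R : Type} {S T : eqType} (s : seq S) (t : seq T) (F G : S -> T -> R) :
  {in s & t, F =2 G} -> mxL s t F = mxL s t G.
Proof.
move=> h; apply/matrixP => i j; rewrite !mxE h //.
  exact: (mem_tnth i (in_tuple s)).
exact: (mem_tnth j (in_tuple t)).
Qed.

Lemma map_mxL {R R' S T : Type} (f : R -> R') (s : seq S) (t : seq T) (F : S -> T -> R) :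
  map_mx f (mxL s t F) = mxL s t (fun x y => f (F x y)).
Proof. by apply/matrixP => i j; rewrite !mxE. Qed.

Lemma tr_mxL {R S T : Type} (s : seq S) (t : seq T) (F : S -> T -> R) :
  (mxL s t F)^T = mxL t s (fun y x => F x y).
Proof. by apply/matrixP => i j; rewrite !mxE. Qed.

Lemma mul_mxL {R : pzRingType} {S T U : Type} (s : seq S) (t : seq T) (u : seq U)
    (F : S -> T -> R) (G : T -> U -> R) :
  mxL s t F *m mxL t u G = mxL s u (fun x z => \sum_(y <- t) F x y * G y z).
Proof.
apply/matrixP => i j; rewrite !mxE [RHS]big_tnth; apply: eq_bigr => k _.
by rewrite !mxE.
Qed.

Lemma mul_mxL_diag {R : pzRingType} {S T : Type} (s : seq S) (t : seq T)
    (F : S -> T -> R) (c : T -> R) :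
  mxL s t F *m diag_mx (\row_j c (tnth (in_tuple t) j)) = mxL s t (fun x y => F x y * c y).
Proof. by rewrite mul_mx_diag; apply/matrixP => i j; rewrite !mxE. Qed.

Lemma perm_mxL {R : Type} {S : eqType} (s t : seq S) (F : S -> S -> R) :
  perm_eq s t -> exists (e : size s = size t) (p : 'S_(size t)),
    castmx (e, e) (mxL s s F) = row_perm p (col_perm p (mxL t t F)).
Proof.
move=> st; have e := perm_size st; exists e.
have st' : perm_eq (tcast e (in_tuple s)) (in_tuple t) by rewrite val_tcast.
have /tuple_permP[p hp] := st'.
exists p; apply/matrixP => i j; rewrite castmxE !mxE /=.
have h k : tnth (in_tuple s) (cast_ord (esym e) k) = tnth (in_tuple t) (p k).
  rewrite -tcastE; have : tcast e (in_tuple s) = [tuple tnth (in_tuple t) (p i) | i < size t].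
    exact: val_inj.
  by move=> ->; rewrite tnth_mktuple.
by rewrite !h.
Qed.

Lemma det_mxL_perm {R : comNzRingType} {S : eqType} (s t : seq S) (F : S -> S -> R) :
  perm_eq s t -> \det (mxL s s F) = \det (mxL t t F).
Proof.
move=> /(@perm_mxL _ _ _ _ F)[e [p E]].
have -> : \det (mxL s s F) = \det (castmx (e, e) (mxL s s F)).
  by move: (size t) e {p E} => k e; subst k; rewrite castmx_id.
rewrite E row_permE col_permE !det_mulmx !det_perm odd_permV mulrCA.
by rewrite -signr_addb addbb mulr1.
Qed.

Lemma dr_mxL {R S : Type} (a : S) (s : seq S) (F : S -> S -> R) :
  drsubmx (mxL (a :: s) (a :: s) F : 'M_(1 + size s, 1 + size s)) = mxL s s F.
Proof.
apply/matrixP => i j; rewrite !mxE.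
by rewrite !(tnth_nth a) /=.
Qed.

End SeqMatrix.

(** * Laplacian determinants on zero-sum functions *)

Section ZeroSum.
Context {R : realFieldType}.

Lemma det_bordered_ones n :
  \det (block_mx 1%:M (- const_mx 1) (const_mx 1) 1%:M : 'M[R]_(1 + n)) = n.+1%:R.
Proof.
rewrite det_schur ?unitmx1 // invmx1 mulmx1 det1 mulr1 mulNmx opprK.
rewrite det_mx11 !mxE eqxx /= (eq_bigr (fun=> 1)); last by move=> i _; rewrite !mxE mulr1.
by rewrite sumr_const card_ord -[LHS](natrD _ 1 n).
Qed.

Lemma det_bordered_ones' n :
  \det (block_mx 1%:M (const_mx 1) (- const_mx 1) 1%:M : 'M[R]_(1 + n)) = n.+1%:R.
Proof.
rewrite -det_bordered_ones -[RHS]det_tr tr_block_mx linearN /= !trmx_const.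
by rewrite !trmx1.
Qed.

Lemma det_1_addJ n : \det (1%:M + const_mx 1 : 'M[R]_n) = n.+1%:R.
Proof.
rewrite -(@det_bordered_ones n).
have -> : block_mx 1%:M (- const_mx 1) (const_mx 1) 1%:M =
  block_mx 1%:M 0 (const_mx 1) 1%:M *m block_mx 1%:M (- const_mx 1) 0 (1%:M + const_mx 1)
  :> 'M[R]_(1 + n).
  rewrite mulmx_block !mul0mx !mulmx0 !mul1mx !addr0 ?add0r ?mulmx1; congr block_mx.
  rewrite mulmxN addrCA (_ : const_mx 1 *m const_mx 1 = const_mx 1) ?addNr ?addr0 //.
  by apply/matrixP => i j; rewrite !mxE big_ord1 !mxE mulr1.
by rewrite det_mulmx det_lblock det_ublock !det1 !mul1r.
Qed.

Context {V : eqType} (F : V -> V -> R).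
Hypothesis symF : forall u w, F u w = F w u.

(** Zero row sums express minus column [v] as the sum of the other columns, so subtracting column
    [v] is right multiplication by the identity plus the all-ones matrix. *)
Lemma det_zero_sum_minor (v : V) (s : seq V) :
  (forall u, \sum_(w <- v :: s) F u w = 0) ->
  \det (mxL s s (fun u w => F u w - F u v)) = (size s).+1%:R * \det (mxL s s F).
Proof.
move=> F0; rewrite mulrC -det_1_addJ -det_mulmx; congr (\det _).
apply/matrixP => i j; rewrite mulmxDr mulmx1 [RHS]mxE !mxE; congr (_ + _).
have := F0 (tnth (in_tuple s) i); rewrite big_cons => /eqP.
rewrite addr_eq0 => /eqP ->; rewrite opprK [LHS]big_tnth; apply: eq_bigr => k _.
by rewrite !mxE mulr1.
Qed.

(** The left-hand side treats all vertices alike, whence the minor on the right cannot depend on the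
    deleted vertex. The factorization uses zero row sums and, by symmetry, zero column sums. *)
Lemma det_add_ones (v : V) (s : seq V) :
  (forall u, \sum_(w <- v :: s) F u w = 0) ->
  \det (mxL (v :: s) (v :: s) (fun u w => F u w + 1)) =
  (size s).+1%:R ^+ 2 * \det (mxL s s F).
Proof.
move=> F0; pose n := size s.
pose M := mxL s s F.
have E : mxL (v :: s) (v :: s) (fun u w => F u w + 1) =
    (block_mx 1%:M (- const_mx 1) (const_mx 1) 1%:M : 'M[R]_(1 + n)) *m
    (block_mx 1%:M 0 0 M : 'M[R]_(1 + n)) *m
    (block_mx 1%:M (const_mx 1) (- const_mx 1) 1%:M : 'M[R]_(1 + n)) :> 'M[R]_(1 + n).
  rewrite !mulmx_block !mul1mx !mulmx1 !mulmx0 !addr0 !add0r ?mul1mx.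
  have cF u : F u v = - \sum_(k < size s) F u (tnth (in_tuple s) k).
    by have := F0 u; rewrite big_cons big_tnth => /eqP; rewrite addr_eq0 => /eqP.
  have eM : - const_mx 1 *m M = \row_j F v (tnth (in_tuple s) j) :> 'M_(1, n).
    apply/matrixP => i j; rewrite !mxE symF cF -sumrN; apply: eq_bigr => k _.
    by rewrite !mxE mulN1r symF.
  rewrite eM; apply/matrixP => i j; rewrite [LHS]mxE.
  case: (@split_ordP 1 n i) => i' ->; case: (@split_ordP 1 n j) => j' ->.
  - rewrite block_mxEul !(tnth_nth v) /= !ord1 /= [RHS]mxE [LHS]addrC.
    congr (_ + _); first by rewrite mxE.
    rewrite cF -sumrN [RHS]mxE; apply: eq_bigr => k _.
    by rewrite !mxE mulrN1.
  - rewrite block_mxEur !(tnth_nth v) /= !ord1 /= [RHS]mxE [LHS]addrC.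
    by congr (_ + _); rewrite mxE ?(tnth_nth v).
  - rewrite block_mxEdl !(tnth_nth v) /= !ord1 /= [RHS]mxE [LHS]addrC.
    congr (_ + _); first by rewrite mxE.
    rewrite cF -sumrN [RHS]mxE; apply: eq_bigr => k _.
    by rewrite !mxE !(tnth_nth v) /= mulrN1.
  - rewrite block_mxEdr !(tnth_nth v) /= [RHS]mxE [LHS]addrC.
    congr (_ + _); first by rewrite mxE big_ord1 !mxE mulr1.
    by rewrite mxE !(tnth_nth v).
apply: (etrans (congr1 (@determinant R (1 + n)) E)).
rewrite !det_mulmx det_bordered_ones det_bordered_ones' det_ublock det1 mul1r.
by rewrite mulrAC expr2.
Qed.

Lemma det_zero_sum_invariant (v w : V) (s t : seq V) :
  perm_eq (v :: s) (w :: t) -> (forall u, \sum_(w <- v :: s) F u w = 0) ->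
  \det (mxL s s F) = \det (mxL t t F).
Proof.
move=> st F0; have F0' u : \sum_(z <- w :: t) F u z = 0 by rewrite -(perm_big _ st).
have [es] := perm_size st.
have := det_add_ones F0; rewrite (det_mxL_perm _ st) det_add_ones //.
have -> : (size t).+1 = (size s).+1 by rewrite es.
by move/mulfI => -> //; rewrite expf_neq0 // pnatr_eq0.
Qed.

End ZeroSum.

Lemma lap_entryC {R : comNzRingType} {V B : eqType} (es : seq B) (ends : B -> V * V)
    (c : B -> R) u w : lap_entry es ends c u w = lap_entry es ends c w u.
Proof. by apply: eq_bigr => b _; rewrite (mulrC (_ - _)). Qed.

(** Makes any vertex available as root. The prefactor is the same for all conductances, so it
    cancels when two determinants on the same graph are compared. *)
Lemma det_zero_sumE {R : realFieldType} {V B : eqType} (vs s : seq V) (v0 w : V)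
    (es : seq B) (ends : B -> V * V) (c : B -> R) :
  uniq vs -> (forall b, b \in es -> ((ends b).1 \in vs) && ((ends b).2 \in vs)) ->
  perm_eq vs (w :: s) ->
  det_zero_sum vs v0 es ends c = (size vs)%:R * \det (mxL s s (lap_entry es ends c)).
Proof.
move=> uvs hes; case: vs uvs hes => [|v t] uvs hes st; first by have := perm_size st.
have sum1 x : x \in v :: t -> \sum_(z <- v :: t) (z == x)%:R = 1 :> R.
  move=> xin; rewrite (bigD1_seq x) //= eqxx big1 ?addr0 // => i /negbTE ->.
  by [].
have F0 u : \sum_(z <- v :: t) lap_entry es ends c u z = 0.
  rewrite /lap_entry exchange_big /= big_seq big1 // => b /hes /andP[h1 h2].
  by rewrite -mulr_sumr -mulr_sumr sumrB !sum1 // subrr !mulr0.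
rewrite -(det_zero_sum_invariant (lap_entryC es ends c) st F0).
rewrite -(det_zero_sum_minor F0); congr (\det _).
by apply/matrixP => i j; rewrite !mxE !(tnth_nth v0).
Qed.

(** * Sums over lists and functions supported on them *)

Lemma eq_big_supp {K : eqType} {idx : K} (op : Monoid.com_law idx) {B : eqType}
    (es fs : seq B) (G : B -> K) :
  uniq es -> uniq fs -> (forall b, G b != idx -> (b \in es) = (b \in fs)) ->
  \big[op/idx]_(b <- es) G b = \big[op/idx]_(b <- fs) G b.
Proof.
move=> ues ufs h.
have red s : \big[op/idx]_(b <- s) G b = \big[op/idx]_(b <- [seq b <- s | G b != idx]) G b.
  rewrite big_filter [RHS]big_mkcond; apply: eq_bigr => b _.
  by case: eqP => //= ->.
rewrite (red es) (red fs); apply/perm_big/uniq_perm; rewrite ?filter_uniq // => b.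
by rewrite !mem_filter; have [//|/h ->] := eqVneq (G b) idx.
Qed.

Lemma sum_indicator {K : pzRingType} {T : eqType} (s : seq T) (x : T) (f : T -> K) :
  uniq s -> (x \notin s -> f x = 0) -> \sum_(y <- s) (y == x)%:R * f y = f x.
Proof.
move=> us fx; rewrite (@eq_big_supp _ _ _ _ s [:: x]) //.
  by rewrite big_seq1 eqxx mul1r.
move=> b; have [-> | /negbTE bx] := eqVneq b x; last by rewrite mul0r eqxx.
by rewrite mul1r mem_seq1 eqxx; apply: contra_neqT => /fx.
Qed.

Lemma mul_mxL_col {K : pzRingType} {S T : Type} (s : seq S) (t : seq T)
    (F : S -> T -> K) (w : T -> K) :
  mxL s t F *m (\col_j w (tnth (in_tuple t) j)) =
  \col_i \sum_(y <- t) F (tnth (in_tuple s) i) y * w y.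
Proof.
by apply/matrixP => i j; rewrite !mxE [RHS]big_tnth; apply: eq_bigr => k _; rewrite !mxE.
Qed.

(** Extension by zero turns vectors into functions on the whole lattice, where divergence and
    boundary are given by local coordinate formulas. *)
Lemma col_seq_fun {K : nmodType} {T : eqType} (t : seq T) (z : 'cV[K]_(size t)) :
  uniq t -> exists w : T -> K, (forall b, b \notin t -> w b = 0) /\
    z = \col_j w (tnth (in_tuple t) j).
Proof.
move=> ut; exists (fun b => \sum_(j | tnth (in_tuple t) j == b) z j 0); split.
  move=> b bt; rewrite big_pred0 // => j; apply: contraNF bt => /eqP <-.
  exact: (mem_tnth j (in_tuple t)).
apply/matrixP => i j; rewrite ord1 mxE (big_pred1 i) // => k.
by rewrite (inj_eq (@tuple_uniqP _ _ (in_tuple t) ut)).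
Qed.

(** * Bonds and plaquettes of the square lattice *)

Definition zends (b : bond) : pt * pt := (bsrc b, btgt b).

Definition inc {K : pzRingType} (u : pt) (b : bond) : K :=
  (u == bsrc b)%:R - (u == btgt b)%:R.

Definition star (u : pt) : seq bond :=
  [:: (u, true); (u, false); ((u.1 - 1, u.2), true); ((u.1, u.2 - 1), false)].

(* The bond crossed by [b], whose plaquettes are named by their lower left corners:
   the dual lattice is thereby shifted by (-1/2, -1/2) onto Z^2. *)
Definition dshift (b : bond) : bond :=
  if b.2 then ((b.1.1, b.1.2 - 1), false) else ((b.1.1 - 1, b.1.2), true).
Definition dunshift (b : bond) : bond :=
  if b.2 then ((b.1.1 + 1, b.1.2), false) else ((b.1.1, b.1.2 + 1), true).

Lemma dshiftK : cancel dshift dunshift.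
Proof. by case=> [[x y] [|]]; rewrite /dunshift /dshift /= subrK. Qed.

Lemma dunshiftK : cancel dunshift dshift.
Proof. by case=> [[x y] [|]]; rewrite /dunshift /dshift /= addrK. Qed.

Lemma star_uniq u : uniq (star u).
Proof. by case: u => x y; rewrite /= !inE -!pair_eqE /pair_eq /= -!pair_eqE /pair_eq /=; lia. Qed.

Lemma mem_star u b : (b \in star u) = (u == bsrc b) || (u == btgt b).
Proof.
case: u b => [x y] [[x' y'] []]; rewrite !inE -!pair_eqE /pair_eq /bsrc /btgt /padd /=
  -!pair_eqE /pair_eq /=; lia.
Qed.

Lemma inc_star {K : pzRingType} u b : b \notin star u -> inc u b = 0 :> K.
Proof. by rewrite mem_star negb_or /inc => /andP[/negbTE -> /negbTE ->]; rewrite subrr. Qed.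

Definition div (w : bond -> int) (v : pt) : int :=
  w (v, true) + w (v, false) - w ((v.1 - 1, v.2), true) - w ((v.1, v.2 - 1), false).

Lemma sum_inc (es : seq bond) (w : bond -> int) v :
  uniq es -> (forall b, b \notin es -> w b = 0) ->
  \sum_(b <- es) inc v b * w b = div w v.
Proof.
move=> ues wes; rewrite (@eq_big_supp _ _ _ _ es (star v)) ?star_uniq //.
  rewrite !big_cons big_nil /inc /div /bsrc /btgt /padd /=.
  case: v => x y; rewrite !xpair_eqE /= !subrK !eqxx !addr0.
  have h (z : int) : (z == z + 1) = false by lia.
  have h' (z : int) : (z == z - 1) = false by lia.
  by rewrite !h !h' /= !andbF /=; lia.
move=> b; rewrite mulf_eq0 negb_or => /andP[h1 h2].
have -> : b \in es by apply: contraNT h2 => /wes ->.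
by apply/esym; apply: contraNT h1 => /(@inc_star int) ->.
Qed.

Definition corners (a : pt) : seq pt :=
  [:: a; (a.1 + 1, a.2); (a.1, a.2 + 1); (a.1 + 1, a.2 + 1)].

Definition full (I : seq pt) (a : pt) : bool := all [in I] (corners a).

(** A full plaquette has its lower left corner in [I], so filtering [I] misses none of them and
    embeds the inner dual vertices into [I]. *)
Definition faces (I : seq pt) : seq pt := [seq a <- I | full I a].

Lemma mem_faces I a : (a \in faces I) = full I a.
Proof. by rewrite mem_filter /full /=; case: (a \in I); rewrite ?andbT ?andbF. Qed.

Lemma mem_Eint I b : (b \in Eint I) = (bsrc b \in I) && (btgt b \in I).
Proof.
rewrite mem_filter andbC mem_cat; congr (_ && _).
have hm (c : bool) : (b \in [seq (v, c) | v <- I]) = (b.2 == c) && (bsrc b \in I).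
  apply/mapP/andP => [[v vI ->]|[/eqP <- h]]; first by rewrite eqxx.
  by exists b.1 => //; case: (b).
by rewrite !hm; case: b.2 => /=; rewrite ?orbF.
Qed.

Lemma Eint_uniq I : uniq I -> uniq (Eint I).
Proof.
move=> uI; apply: filter_uniq; rewrite cat_uniq !map_inj_uniq ?uI ?andbT /=;
  try by move=> ? ? [].
by apply/hasPn => b /mapP[v _ ->]; apply/negP => /mapP[].
Qed.

(* Boundary of a 2-chain; plaquettes are oriented counter-clockwise. *)
Definition bd2 (f : pt -> int) (b : bond) : int :=
  if b.2 then f b.1 - f (b.1.1, b.1.2 - 1) else f (b.1.1 - 1, b.1.2) - f b.1.

(* Incidence number of the bond [b] in the boundary of the plaquette [a] *)
Definition finc {K : pzRingType} (a : pt) (b : bond) : K :=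
  (if b.2 then -1 else 1) * inc a (dshift b).

Lemma full_star I a b : full I a -> b \in star a -> dunshift b \in Eint I.
Proof.
case: a => x y /and5P[/= h1 h2 h3 h4 _].
by rewrite !inE => /or4P[] /eqP ->;
  rewrite mem_Eint /bsrc /btgt /padd /dunshift /= ?subrK ?addr0 ?h1 ?h2 ?h3 ?h4.
Qed.

Lemma full_inc {K : pzRingType} I a b :
  full I a -> b \notin Eint I -> inc a (dshift b) = 0 :> K.
Proof.
move=> fa bE; apply: inc_star; apply: contra bE => /(full_star fa).
by rewrite dshiftK.
Qed.

Lemma sum_finc I (f : pt -> int) b : uniq I ->
  (forall a, a \notin faces I -> f a = 0) ->
  \sum_(a <- faces I) finc a b * f a = bd2 f b.
Proof.
move=> uI f0; have uF : uniq (faces I) by rewrite filter_uniq.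
have si x : \sum_(a <- faces I) (a == x)%:R * f a = f x.
  by apply: sum_indicator => // /f0.
rewrite /finc; under eq_bigr => a _ do rewrite -mulrA mulrBl.
rewrite -mulr_sumr sumrB !si /bd2 /dshift /bsrc /btgt /padd.
by case: b => [[x y] []] /=; rewrite ?subrK ?addr0; ring.
Qed.

(** * Exactness of the chain complex and planar duality *)

(** Serves to exploit bounded support: a property valid far to the left is carried rightwards along
    horizontal lines. *)
Lemma left_ind (P : int -> int -> Prop) (M : int) :
  (forall x y, x < M -> P x y) -> (forall x y, P (x - 1) y -> P x y) -> forall x y, P x y.
Proof.
move=> P0 PS x y.
have H n : forall x y, x < M + n%:Z -> P x y.
  elim: n => [|n IH] {}x {}y hx; first by apply: P0; lia.
  by apply/PS/IH; lia.
by apply: (H (absz (x - M + 1)) x y); lia.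
Qed.

Lemma leftmost (I : seq pt) : (0 < size I)%N ->
  exists x y, (x, y) \in I /\ forall x' y', (x', y') \in I -> x <= x'.
Proof.
elim: I => // [[a a']] [|b s] IH _.
  by exists a, a'; rewrite mem_head; split=> // x y; rewrite inE => /eqP[->].
have [//|x [y [vI vm]]] := IH; have [le|lt] := leP a x.
  exists a, a'; rewrite mem_head; split=> // u v; rewrite inE => /predU1P[[->]//|/vm].
  exact: le_trans.
exists x, y; rewrite inE vI orbT; split=> // u v.
by rewrite inE => /predU1P[[-> _]|/vm//]; rewrite ltW.
Qed.

Section Exactness.
Variable I : seq pt.
Hypothesis uI : uniq I.
Hypothesis I0 : (0 < size I)%N.

(** On vertical bonds a zero boundary means that [f] agrees at horizontal neighbours, and [f]
    vanishes to the left of [I]. *)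
Lemma bd2_inj (f : pt -> int) :
  (forall a, a \notin faces I -> f a = 0) -> (forall b, b \in Eint I -> bd2 f b = 0) ->
  forall a, f a = 0.
Proof.
move=> f0 bf; have bf' b : bd2 f b = 0.
  have [/bf//|bE] := boolP (b \in Eint I).
  rewrite -(sum_finc _ uI) // big_seq big1 // => a; rewrite mem_faces => fa.
  by rewrite /finc (full_inc fa bE) mulr0 mul0r.
have [x0 [y0 [_ vm]]] := leftmost I0.
suff H x y : f (x, y) = 0 by case.
apply: (@left_ind (fun x y => f (x, y) = 0) x0) => {}x {}y h.
  apply: f0; rewrite mem_filter negb_and; apply/orP; right.
  by apply/negP => /vm; lia.
by have := bf' ((x, y), false); rewrite /bd2 /= h; lia.
Qed.

Variable g : seq pt.
(** The absence of holes enters through these two properties: every plaquette partly in [I] lies on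
    the one closed path, and a chain whose boundary lives on interior bonds does not change along
    that path. *)
Hypothesis mixed_g : forall a, ~~ full I a -> has [in I] (corners a) -> a \in g.
Hypothesis const_g : forall f : pt -> int,
  (forall b, b \notin Eint I -> bd2 f b = 0) -> {in g &, forall a a', f a = f a'}.

(* A cycle [w] is the boundary of the chain [f] whose value at a plaquette is the flow of [w] across
   the horizontal half-line to its left; [f] vanishes at a leftmost plaquette met by the
   contour, hence along the whole contour. *)
Lemma cycle_exact (w : bond -> int) :
  (forall b, b \notin Eint I -> w b = 0) -> (forall v, div w v = 0) ->
  exists f : pt -> int, (forall a, a \notin faces I -> f a = 0) /\ forall b, bd2 f b = w b.
Proof.
move=> w0 dw; have uE := Eint_uniq uI; have [x0 [y0 [v0I vm]]] := leftmost I0.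
pose f (a : pt) : int := - \sum_(b <- Eint I)
  (~~ b.2 && (b.1.2 == a.2) && (b.1.1 <= a.1))%:R * w b.
have fF (x y : int) : f (x - 1, y) - f (x, y) = w ((x, y), false).
  rewrite /f opprK addrC -sumrB.
  rewrite -(@sum_indicator _ _ (Eint I) ((x, y), false) w) //; last exact: w0.
  apply: eq_bigr => b _; rewrite -mulrBl; congr (_ * _).
  by case: b => [[x' y'] []]; rewrite -!pair_eqE /pair_eq /= -?pair_eqE /pair_eq /= ?andbF //; lia.
have f_left (x y : int) : x < x0 -> f (x, y) = 0.
  move=> h; rewrite /f big_seq big1 ?oppr0 // => -[[x' y'] b].
  rewrite mem_Eint => /andP[/vm hb _] /=.
  have -> : (x' <= x) = false by lia.
  by rewrite andbF mul0r.
have w_left (x y : int) : x < x0 -> w ((x, y), true) = 0.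
  move=> h; apply: w0; rewrite mem_Eint negb_and; apply/orP; left.
  by apply/negP => /vm; lia.
(* Zero divergence at [(x, y)] passes the identity from the horizontal bond on its left to the one
   on its right. *)
have fT (x y : int) : f (x, y) - f (x, y - 1) = w ((x, y), true).
  apply: (@left_ind (fun x y => f (x, y) - f (x, y - 1) = w ((x, y), true)) x0) => {}x {}y.
    by move=> h; rewrite !f_left ?w_left.
  move=> IH; have := dw (x, y); rewrite /div /=.
  rewrite -(fF x y) -(fF x (y - 1)) -IH => dxy.
  by apply: subr0_eq; rewrite -[RHS]oppr0 -[in RHS]dxy; ring.
have bf b : bd2 f b = w b.
  by case: b => [[x y] []]; rewrite /bd2 /= ?fT ?fF.
have fg a : a \in g -> f a = 0.
  (* This plaquette lies just left of a leftmost vertex of [I]: its right side meets [I], its left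
     side does not. *)
  have a0g : (x0 - 1, y0) \in g.
    apply: mixed_g; last by rewrite /= subrK v0I /= orbT.
    by rewrite /full /= negb_and; apply/orP; left; apply/negP => /vm; lia.
  move=> ag; rewrite (@const_g f _ _ _ ag a0g); first by apply: f_left; lia.
  by move=> b /w0; rewrite bf.
exists f; split=> // -[x y].
(* Off the contour a plaquette that is not full has no corner in [I]. Nothing then flows through its
   left side, and its left neighbour is not full either, so zero is inherited from there. *)
apply: (@left_ind (fun x y => (x, y) \notin faces I -> f (x, y) = 0) x0) => {}x {}y.
  by move=> /f_left.
rewrite !mem_faces => IH nf; have [/fg//|ng] := boolP ((x, y) \in g).
have nI : ~~ has [in I] (corners (x, y)) by apply: contra ng; apply: mixed_g.
have aI : (x, y) \notin I by apply: contra nI => h; rewrite /= h.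
have := fF x y; rewrite w0; last by rewrite mem_Eint /bsrc /= (negbTE aI).
rewrite IH; first by lia.
by rewrite /full /= subrK (negbTE aI) andbF.
Qed.

Variables (v0 : pt) (I' : seq pt).
Hypothesis pI : perm_eq I (v0 :: I').
Hypothesis conn : forall v, v \in I -> exists w : bond -> int,
  (forall b, b \notin Eint I -> w b = 0) /\
  forall x, div w x = (x == v)%:R - (x == v0)%:R.

(** Plaquettes, bonds and vertices without the root [v0] form a short exact sequence, to which
    [det_duality] applies. The equality of sizes is Euler's formula; the orientation signs in [finc]
    square away in the dual Laplacian. *)
Theorem planar_duality (F : realFieldType) :
  [/\ (size I' + size (faces I))%N = size (Eint I),
      forall x : 'rV[F]_(size I'), x *m mxL I' (Eint I) inc = 0 -> x = 0 &
      forall c : bond -> F, (forall b, c b != 0) ->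
        \det (mxL I' I' (lap_entry (Eint I) zends c)) =
        (\prod_(b <- Eint I) c b) *
        \det (mxL (faces I) (faces I)
          (lap_entry (Eint I) (fun b => zends (dshift b)) (fun b => (c b)^-1)))].
Proof.
have uE := Eint_uniq uI.
have /andP[v0I' uI'] : (v0 \notin I') && uniq I' by rewrite -cons_uniq -(perm_uniq pI).
have I'I x : x \in I' -> x \in I by move=> h; rewrite (perm_mem pI) inE h orbT.
have [] := @det_duality F _ _ _ (mxL I' (Eint I) inc) (mxL (faces I) (Eint I) finc).
- move=> i; have iI' := mem_tnth i (in_tuple I').
  have [w [w0 dw]] := conn (I'I _ iI').
  exists (\col_j w (tnth (in_tuple (Eint I)) j)); rewrite mul_mxL_col.
  apply/matrixP => k j; rewrite ord1 !mxE sum_inc // dw eqxx andbT.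
  rewrite (inj_eq (@tuple_uniqP _ _ (in_tuple I') uI')).
  have -> : (tnth (in_tuple I') k == v0) = false; last by rewrite subr0.
  by apply: contraNF v0I' => /eqP <-; apply: (mem_tnth k (in_tuple I')).
- rewrite tr_mxL mul_mxL; apply/matrixP => i j; rewrite !mxE.
  set v := tnth _ _; set a := tnth (in_tuple (faces I)) j.
  have : a \in faces I := mem_tnth j (in_tuple (faces I)).
  rewrite mem_faces => fa; rewrite sum_inc //; last first.
    by move=> b bE; rewrite /finc (full_inc fa bE) mulr0.
  rewrite /div /finc /inc /dshift /bsrc /btgt /padd /=; move: a v {fa} => [x y] [x' y'].
  by rewrite /= !xpair_eqE /= !subrK !addr0; ring.
- move=> z; have [w [w0 ->]] := col_seq_fun z uE.
  rewrite mul_mxL_col => /matrixP Az.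
  have dI' x : x \in I' -> div w x = 0.
    move=> xI'; have /tnthP[i ->] : x \in in_tuple I' := xI'.
    by have := Az i 0; rewrite !mxE sum_inc.
  (* The root has no row in the matrix. The divergence vanishes there too, because every interior
     bond contributes zero to the total divergence. *)
  have dI : \sum_(x <- I) div w x = 0.
    under eq_bigr => x _ do rewrite -(sum_inc _ uE w0).
    rewrite exchange_big big_seq big1 //= => b; rewrite mem_Eint => /andP[bs bt].
    rewrite -mulr_suml sumrB.
    under eq_bigr do rewrite -[(_ == _)%:R]mulr1.
    under [X in _ - X]eq_bigr do rewrite -[(_ == _)%:R]mulr1.
    by rewrite !sum_indicator ?bs ?bt // subrr mul0r.
  have dw x : div w x = 0.
    have [|xI] := boolP (x \in I).
      rewrite (perm_mem pI) inE => /predU1P[->|/dI'//].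
      move: dI; rewrite (perm_big _ pI) big_cons big_seq big1; last by move=> y /dI'.
      by rewrite /= addr0.
    rewrite -(sum_inc _ uE w0) big_seq big1 // => b; rewrite mem_Eint => /andP[bs bt].
    by rewrite inc_star ?mul0r // mem_star negb_or; apply/andP; split;
      apply: contraNneq xI => ->.
  have [f [f0 bf]] := cycle_exact w0 dw.
  exists (\col_j f (tnth (in_tuple (faces I)) j)); rewrite tr_mxL mul_mxL_col.
  by apply/matrixP => i j; rewrite !mxE (sum_finc _ uI).
- move=> y; have uF : uniq (faces I) by rewrite filter_uniq.
  have [f [f0 ->]] := col_seq_fun y uF; rewrite tr_mxL mul_mxL_col => /matrixP By.
  have f00 : forall a, f a = 0.
    apply: bd2_inj => // b bE; have /tnthP[i ->] : b \in in_tuple (Eint I) := bE.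
    by have := By i 0; rewrite !mxE (sum_finc _ uI).
  by apply/matrixP => i j; rewrite !mxE f00.
move=> e injA dual; split=> //.
  move=> x xA; apply: injA; rewrite map_mxL -[RHS]xA; congr (_ *m _).
  by apply: eq_mxL => u b _ _; rewrite /inc rmorphB /= !rmorph_nat.
move=> c c0; pose d := \row_j c (tnth (in_tuple (Eint I)) j).
have d0 i : d 0 i != 0 by rewrite mxE c0.
have -> : \prod_(b <- Eint I) c b = \det (diag_mx d).
  by rewrite det_diag big_tnth; apply: eq_bigr => j _; rewrite mxE.
have h := dual d d0; transitivity (\det (map_mx intr (mxL I' (Eint I) inc) *m
  diag_mx d *m (map_mx intr (mxL I' (Eint I) inc))^T)).
  congr (\det _); rewrite map_mxL mul_mxL_diag tr_mxL mul_mxL.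
  apply: eq_mxL => u v _ _; apply: eq_bigr => b _.
  by rewrite /inc /zends /= !rmorphB /= !rmorph_nat; ring.
rewrite {}h; congr (_ * \det _).
have -> : map_mx (fun x => x^-1) d =
    \row_j (c (tnth (in_tuple (Eint I)) j))^-1 by apply/matrixP => i j; rewrite !mxE.
rewrite map_mxL (mul_mxL_diag _ _ _ (fun b => (c b)^-1)) tr_mxL mul_mxL.
apply: eq_mxL => u v _ _; apply: eq_bigr => b _.
rewrite /finc /inc /zends /= !rmorphM !rmorphB /= !rmorph_nat.
by case: b.2; rewrite ?rmorphN1 ?rmorph1; ring.
Qed.

End Exactness.

(** * Laplacians with Dirichlet boundary conditions *)

Section Laplacian.
Context {R : realFieldType}.

(** Vertices outside [s] are grounded: a bond of [es] with just one end in [s] still adds to the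
    diagonal. *)
Definition lapmx (es : seq bond) (c : bond -> R) (s : seq pt) : 'M[R]_(size s) :=
  mxL s s (lap_entry es zends c).

Lemma lapmx_gram es c s :
  lapmx es c s =
  mxL s es inc *m diag_mx (\row_j c (tnth (in_tuple es) j)) *m (mxL s es inc)^T.
Proof.
rewrite mul_mxL_diag tr_mxL mul_mxL; apply: eq_mxL => u v _ _.
by apply: eq_bigr => b _; rewrite /inc /zends /=; ring.
Qed.

Lemma qform_lapmx es c s (x : 'rV[R]_(size s)) :
  qform (lapmx es c s) x =
  \sum_(b <- es) c b * (\sum_i x 0 i * inc (tnth (in_tuple s) i) b) ^+ 2.
Proof.
rewrite lapmx_gram /qform !mulmxA -mulmxA -trmx_mul mxE [RHS]big_tnth.
apply: eq_bigr => k _; rewrite mul_mx_diag !mxE.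
under eq_bigr do rewrite mxE.
by ring.
Qed.

Lemma lapmx_posdef es c s :
  (forall b, 0 < c b) -> (forall x : 'rV[R]_(size s), x *m mxL s es inc = 0 -> x = 0) ->
  posdef (lapmx es c s).
Proof.
move=> c0 inj; rewrite lapmx_gram; apply: posdef_gram => // i.
by rewrite mxE.
Qed.

(** A kernel vector, extended by zero, has no gradient on any bond; it is constant on horizontal
    lines and zero far to the left. *)
Lemma inc_row_free es s : uniq s -> (0 < size s)%N ->
  (forall b, (bsrc b \in s) || (btgt b \in s) -> b \in es) ->
  forall x : 'rV[R]_(size s), x *m mxL s es inc = 0 -> x = 0.
Proof.
move=> us s0 hes x; have [w [w0 /(congr1 trmx)]] := col_seq_fun x^T us.
rewrite trmxK => -> /(congr1 trmx); rewrite trmx0 trmx_mul tr_mxL trmxK mul_mxL_col.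
move=> /matrixP h.
have gradw b : w (bsrc b) = w (btgt b).
  have [|] := boolP ((bsrc b \in s) || (btgt b \in s)); last first.
    by rewrite negb_or => /andP[/w0 -> /w0 ->].
  move=> /hes bes; have /tnthP[i bi] : b \in in_tuple es := bes.
  have := h i 0; rewrite !mxE -bi /inc.
  under eq_bigr do rewrite mulrBl.
  rewrite sumrB !sum_indicator //; try by apply: w0.
  by move/eqP; rewrite subr_eq0 => /eqP.
have [x0 [y0 [_ vm]]] := leftmost s0.
have wz (a a' : int) : w (a, a') = 0.
  apply: (@left_ind (fun a a' => w (a, a') = 0) x0) => {}a {}a' ha.
    by apply: w0; apply/negP => /vm; lia.
  by have := gradw ((a - 1, a'), true); rewrite /bsrc /btgt /padd /= subrK addr0 ha.
apply/matrixP => i j; rewrite !mxE.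
by case: (tnth _ _) => a a'; rewrite wz.
Qed.

Lemma posdef_mxL_perm (s t : seq pt) (F : pt -> pt -> R) :
  perm_eq s t -> posdef (mxL s s F) -> posdef (mxL t t F).
Proof.
move=> /(@perm_mxL _ _ _ _ F) [e [p E]] pX.
have {pX} : posdef (castmx (e, e) (mxL s s F)).
  by move: (size t) e {p E} => k e; subst k; rewrite castmx_id.
rewrite {}E; move: (mxL t t F) => X; rewrite row_permE col_permE => -[sX pX].
pose P : 'M[R]_(size t) := perm_mx p.
have PP : P^T *m P = 1%:M by rewrite tr_perm_mx -perm_mxM mulVg perm_mx1.
have PP' : P *m P^T = 1%:M by rewrite tr_perm_mx -perm_mxM mulgV perm_mx1.
rewrite -/P -tr_perm_mx -/P in sX pX.
have XE : X = P^T *m (P *m (X *m P^T)) *m P.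
  by rewrite !mulmxA PP mul1mx -mulmxA PP mulmx1.
split.
  by rewrite XE; move: (P *m _) sX => Y sY; rewrite !trmx_mul trmxK sY mulmxA.
move=> x nx; have := pX (x *m P^T).
have -> : qform (P *m (X *m P^T)) (x *m P^T) = qform X x.
  rewrite /qform trmx_mul trmxK !mulmxA; congr (fun_of_matrix _ 0 0).
  by rewrite -[x *m P^T *m P]mulmxA PP mulmx1 -[_ *m P^T *m P]mulmxA PP mulmx1.
apply; apply: contra_neq nx => h.
by rewrite -[x]mulmx1 -PP mulmxA h mul0mx.
Qed.

(** The vertices of [s] are eliminated one at a time. Each Schur complement is a minimum, hence at
    most the value of the form at a unit vector, which is the diagonal entry. *)
Lemma det_mxL_fischer (s t : seq pt) (F : pt -> pt -> R) :
  posdef (mxL (s ++ t) (s ++ t) F) ->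
  posdef (mxL t t F) /\
  \det (mxL (s ++ t) (s ++ t) F) <= (\prod_(a <- s) F a a) * \det (mxL t t F).
Proof.
elim: s => [|a s IH] pX; first by rewrite big_nil mul1r.
have pM : posdef (mxL (s ++ t) (s ++ t) F) by rewrite -(dr_mxL a); apply: posdef_dr.
have [pt leM] := IH pM; split=> //.
have [y [-> /(_ 0) le0]] := @det_posdef_min _ _ (mxL (a :: s ++ t) (a :: s ++ t) F)
  pX.1 (posdef_dr pX).
rewrite big_cons -mulrA dr_mxL; apply: ler_pM => //.
- exact: posdef_ge0.
- exact/ltW/posdef_det_gt0.
apply: le_trans le0 _; rewrite /qform tr_row_mx trmx0 trmx1.
rewrite -[X in _ *m X *m _](@submxK _ 1 _ 1 _) mul_row_block mul_row_col.
rewrite !mul1mx !mul0mx !addr0 mulmx1 mulmx0 addr0 !mxE.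
by rewrite !(tnth_nth a).
Qed.

(* Passing from Dirichlet to free boundary conditions: the Schur complement at [v0] is at
   least the conductance 1 of a bond that joins [v0] to the outside. *)
Lemma det_lapmx_free es es' es'' c v0 s w b0 :
  (forall b, 0 < c b) -> perm_eq es (es' ++ es'') ->
  posdef (lapmx es c (v0 :: s)) -> posdef (lapmx es' c s) ->
  v0 \notin s -> w \notin v0 :: s -> b0 \in es -> c b0 = 1 ->
  zends b0 = (v0, w) \/ zends b0 = (w, v0) ->
  \det (lapmx es' c s) <= \det (lapmx es c (v0 :: s)).
Proof.
move=> c0 pes pX pM0 v0s wI b0es cb0 b0v.
have [y [-> _]] := @det_posdef_min _ _ (lapmx es c (v0 :: s)) pX.1 (posdef_dr pX).
rewrite dr_mxL.
have pM : posdef (lapmx es c s) by rewrite -[lapmx es c s](dr_mxL v0); apply: posdef_dr.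
(* Deleting the bonds of [es''] lowers the quadratic form. *)
have leM : \det (lapmx es' c s) <= \det (lapmx es c s).
  apply: det_posdef_le => // x; rewrite !qform_lapmx (perm_big _ pes) big_cat /=.
  by rewrite lerDl sumr_ge0 // => b _; rewrite mulr_ge0 ?sqr_ge0 // ltW.
apply: le_trans leM _; rewrite ler_peMl ?(ltW (posdef_det_gt0 _)) //.
(* The term of [b0] alone equals 1, since its end [w] is grounded and the coordinate at [v0] is 1;
   all other terms are nonnegative. *)
rewrite (@qform_lapmx _ _ (v0 :: s)) (perm_big _ (perm_to_rem b0es)) big_cons /= cb0 mul1r.
rewrite (@big_ord_recl _ _ _ (size s)) /= !(tnth_nth v0) /=.
rewrite big1; last first.
  move=> i _; rewrite (tnth_nth v0) /=; set u := nth _ _ _.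
  have us : u \in s := mem_nth v0 (ltn_ord i).
  rewrite inc_star ?mulr0 // mem_star negb_or; move: b0v; rewrite /zends => b0v.
  have uv : (u == v0) = false by apply: contraNF v0s => /eqP <-.
  have uw : (u == w) = false by apply: contraNF wI => /eqP <-; rewrite inE us orbT.
  by case: b0v => -[-> ->]; rewrite uv uw.
have -> : row_mx 1%:M y 0 (@ord0 (size s)) = 1.
  have -> : (@ord0 (size s)) = @lshift 1 (size s) 0 by exact: val_inj.
  by rewrite row_mxEl mxE.
have wv : (v0 == w) = false by apply: contraNF wI => /eqP ->; rewrite mem_head.
have -> : (1 * inc v0 b0 + 0) ^+ 2 = 1 :> R.
  rewrite addr0 mul1r /inc; move: b0v; rewrite /zends => -[] [-> ->];
  by rewrite eqxx wv ?subr0 ?sub0r ?sqrrN expr1n.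
by rewrite lerDl sumr_ge0 // => b _; rewrite mulr_ge0 ?sqr_ge0 // ltW.
Qed.

End Laplacian.

Lemma det_mxL_map {R : comNzRingType} {S T : Type} (f : S -> T) (s : seq S) (F : T -> T -> R) :
  \det (mxL (map f s) (map f s) F) = \det (mxL s s (fun x y => F (f x) (f y))).
Proof.
case: s => [|x0 s]; first by rewrite !det_mx00.
set t := x0 :: s; have e := size_map f t.
have -> : mxL t t (fun x y => F (f x) (f y)) = castmx (e, e) (mxL (map f t) (map f t) F).
  apply/matrixP => i j; rewrite castmxE !mxE !(tnth_nth x0) !(tnth_nth (f x0)).
  by rewrite !(nth_map x0) //= ltn_ord.
by move: (size t) e => k e; subst k; rewrite castmx_id.
Qed.

(** * Nearest neighbours and dual bonds *)

Lemma nnC x y : nn x y = nn y x.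
Proof. by rewrite /nn (distrC x.1) (distrC x.2). Qed.

Lemma nn_cases (x y : pt) : nn x y ->
  [\/ y = (x.1 + 1, x.2), y = (x.1 - 1, x.2), y = (x.1, x.2 + 1) | y = (x.1, x.2 - 1)].
Proof.
case: x y => a b [a' b']; rewrite /nn /= => h.
have [h1|[h1|[h1|h1]]] : (a' = a + 1 /\ b' = b) \/ (a' = a - 1 /\ b' = b) \/
  (a' = a /\ b' = b + 1) \/ (a' = a /\ b' = b - 1) by lia.
- by case: h1 => -> ->; constructor 1.
- by case: h1 => -> ->; constructor 2.
- by case: h1 => -> ->; constructor 3.
- by case: h1 => -> ->; constructor 4.
Qed.

Lemma nn_zends b : nn (bsrc b) (btgt b).
Proof. by case: b => [[x y] []]; rewrite /nn /bsrc /btgt /padd /=; lia. Qed.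

Lemma ubond_zends b : ubond (bsrc b) (btgt b) = b.
Proof.
case: b => [[x y] []]; rewrite /ubond /bsrc /btgt /padd /=.
  by rewrite ltrDl ltr01.
by rewrite addr0 ltxx ltrDl ltr01.
Qed.

Lemma zends_ubond x y : nn x y ->
  zends (ubond x y) = (x, y) \/ zends (ubond x y) = (y, x).
Proof.
case: x => a b /nn_cases[] -> /=; rewrite /ubond /zends /bsrc /btgt /padd /=.
- by left; rewrite ltrDl ltr01 /= addr0.
- by right; rewrite gtrBl ltr01 /= [a < _]ltNge lerBlDr lerDl ler01 /= subrK addr0.
- by left; rewrite ltxx ltrDl ltr01 /= addr0.
- by right; rewrite ltxx [b < _]ltNge lerBlDr lerDl ler01 /= subrK addr0.
Qed.

Lemma ubond_zendsC b : ubond (btgt b) (bsrc b) = b.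
Proof.
case: b => [[x y] []]; rewrite /ubond /bsrc /btgt /padd /=.
  by rewrite ltrDl ltr01 [x + 1 < _]ltNge lerDl ler01.
by rewrite addr0 ltxx [y + 1 < _]ltNge lerDl ler01.
Qed.

(** The dual point encoded by [a] is the centre of the plaquette with lower left corner [a], so dual
    bonds in doubled coordinates match [dshift]. The order of the ends depends on the direction of
    the primal bond. *)
Lemma dual_dbond_ends x y a a' : nn x y ->
  dual_dbond x y = (dbl_dual a, dbl_dual a') ->
  zends (dshift (ubond x y)) = (a, a') \/ zends (dshift (ubond x y)) = (a', a).
Proof.
case: x a a' => u v [a1 a2] [b1 b2] xy.
rewrite /dual_dbond /dbl_dual /padd /psub /perp /=.
case: (nn_cases xy) => {xy} -> /= -[e1 e2 e3 e4].
- have [E1 E2 E3 E4] : [/\ a1 = u, a2 = v - 1, b1 = u & b2 = v] by split; lia.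
  rewrite E1 E2 E3 E4; left.
  by rewrite /ubond /= ltrDl ltr01 /dshift /zends /bsrc /btgt /padd /= subrK addr0.
- have [E1 E2 E3 E4] : [/\ a1 = u - 1, a2 = v, b1 = u - 1 & b2 = v - 1] by split; lia.
  rewrite E1 E2 E3 E4; right; rewrite /ubond /= gtrBl ltr01 [u < _]ltNge lerBlDr lerDl ler01.
  by rewrite /dshift /zends /bsrc /btgt /padd /= subrK addr0.
- have [E1 E2 E3 E4] : [/\ a1 = u, a2 = v, b1 = u - 1 & b2 = v] by split; lia.
  rewrite E1 E2 E3 E4; right.
  by rewrite /ubond /= ltxx ltrDl ltr01 /dshift /zends /bsrc /btgt /padd /= subrK addr0.
- have [E1 E2 E3 E4] : [/\ a1 = u - 1, a2 = v - 1, b1 = u & b2 = v - 1] by split; lia.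
  rewrite E1 E2 E3 E4; left; rewrite /ubond /= ltxx [v < _]ltNge lerBlDr lerDl ler01.
  by rewrite /dshift /zends /bsrc /btgt /padd /= subrK addr0.
Qed.

Lemma mem_plaq_faces a b : (b \in plaq_faces a) = (dshift b \in star a).
Proof.
case: a b => [x y] [[x' y'] []]; rewrite /plaq_faces /dshift !inE -!pair_eqE /pair_eq /=
  -!pair_eqE /pair_eq /=; lia.
Qed.

Lemma dshift_star_cases a b x y :
  zends (dshift b) = (x, y) -> (dshift b \in star a) = (a == x) || (a == y).
Proof. by rewrite mem_star => -[<- <-]. Qed.

(** Membership in [I] is not constant on the corners, so it changes along some side. *)
Lemma mixed_face I a : ~~ full I a -> has [in I] (corners a) ->
  exists2 b, b \in plaq_faces a & (bsrc b \in I) != (btgt b \in I).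
Proof.
case: a => x y; rewrite /full /= !andbT !orbF => nf h.
suff /hasP[b bf hb] : has (fun b => (bsrc b \in I) != (btgt b \in I)) (plaq_faces (x, y)).
  by exists b.
move: nf h; rewrite /= /bsrc /btgt /padd /= !addr0.
by case: ((x, y) \in I); case: ((x + 1, y) \in I); case: ((x, y + 1) \in I);
  case: ((x + 1, y + 1) \in I).
Qed.

(** * Geometry of a contour and its interior *)

Section Contour.
Variables (g zs ys I : seq pt).
Hypothesis hg : dual_closed_path g.
Hypothesis hz : primal_bonds g zs ys.
Hypothesis hI : is_interior zs ys I.
(** For a q-contour with [1 < q] this is [qcontour_disjoint]. *)
Hypothesis disj : forall b, b \in Egamma zs ys -> b \notin Eint I.

Let z i := nth pt0 zs i.
Let y i := nth pt0 ys i.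
Let uI : uniq I := hI.1.
Let I0 : (0 < size I)%N := hI.2.1.

Lemma Egamma_nth i : (i < size g)%N -> ubond (z i) (y i) \in Egamma zs ys.
Proof.
case: hz => sz [sy _] ig; rewrite mem_undup; apply/mapP; exists (z i, y i) => //.
by rewrite /z /y -nth_zip ?sz ?sy // mem_nth // size_zip sz sy minnn.
Qed.

Lemma EgammaP b : b \in Egamma zs ys -> exists2 i, (i < size g)%N & b = ubond (z i) (y i).
Proof.
case: hz => sz [sy _]; rewrite mem_undup => /mapP[zy /(nthP (pt0, pt0))[i]].
rewrite size_zip sz sy minnn => ig <- ->; exists i => //.
by rewrite nth_zip ?sz ?sy.
Qed.

Lemma contour_inner i : (i < size g)%N -> z i \in I.
Proof.
move=> ig; case: hI => _ [_ [_ h]]; apply: (proj1 (proj2 (h (z i)) _)).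
by rewrite mem_nth // hz.1.
Qed.

Lemma contour_outer i : (i < size g)%N -> y i \notin I.
Proof.
move=> ig; apply: contra (disj (Egamma_nth ig)) => yI.
have [nn_zy _] := hz.2.2 i ig; rewrite mem_Eint.
by case: (zends_ubond nn_zy) => -[-> ->]; rewrite yI contour_inner.
Qed.

(** A contour bond leads from [z i] inside to [y i] outside. Conversely, a bond leaving the
    component must be in E(gamma), for otherwise its outer end would be connected to the
    component. *)
Lemma Egamma_boundary b : (b \in Egamma zs ys) = ((bsrc b \in I) != (btgt b \in I)).
Proof.
apply/idP/idP.
  move=> /EgammaP[i ig ->]; have [nn_zy _] := hz.2.2 i ig.
  by case: (zends_ubond nn_zy) => -[-> ->];
    rewrite contour_inner // (negbTE (contour_outer ig)).
have closed x w : x \in I -> w \notin I -> nn x w -> ubond x w \in Egamma zs ys.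
  move=> xI wI xw; apply: contraNT wI => nE; case: hI => _ [_ [comp _]].
  apply/(comp x w xI); exists [:: w]; split=> //=.
  by rewrite /open_adj xw nE.
have := closed (bsrc b) (btgt b); have := closed (btgt b) (bsrc b).
rewrite ubond_zends ubond_zendsC nnC nn_zends.
by case: (bsrc b \in I); case: (btgt b \in I) => //= h1 h2 _; [apply: h2|apply: h1].
Qed.

Lemma mem_EG b : (b \in EG zs ys I) = (bsrc b \in I) || (btgt b \in I).
Proof.
rewrite mem_undup mem_cat mem_Eint Egamma_boundary.
by case: (bsrc b \in I); case: (btgt b \in I).
Qed.

Lemma perm_EG : perm_eq (EG zs ys I) (Eint I ++ Egamma zs ys).
Proof.
rewrite /EG undup_id // cat_uniq Eint_uniq // undup_uniq andbT.
by apply/hasPn => b /disj.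
Qed.

(** A side along which membership in [I] changes is a contour bond; its dual is a step of gamma,
    with the plaquette at one of its ends. *)
Lemma mixed_contour a : ~~ full I a -> has [in I] (corners a) -> a \in g.
Proof.
move=> nf h; have [b] := mixed_face nf h; rewrite -Egamma_boundary => + bE.
have [i ig ->] := EgammaP bE; have [nn_zy /(dual_dbond_ends nn_zy) E] := hz.2.2 i ig.
have nextg : cnext g i \in g by rewrite mem_nth // ltn_mod hg.1.
rewrite mem_plaq_faces.
by case: E => E; rewrite (dshift_star_cases _ E) => /orP[] /eqP -> //; rewrite mem_nth.
Qed.

(** Consecutive plaquettes of gamma are separated by a contour bond, which is not interior, so [f]
    does not jump there. *)
Lemma contour_const (f : pt -> int) : (forall b, b \notin Eint I -> bd2 f b = 0) ->
  {in g &, forall a a', f a = f a'}.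
Proof.
move=> f0.
have step i : (i < size g)%N -> f (nth pt0 g i) = f (cnext g i).
  move=> ig; have := f0 _ (disj (Egamma_nth ig)).
  have [nn_zy /(dual_dbond_ends nn_zy) E] := hz.2.2 i ig.
  have bdE b : bd2 f b = (if b.2 then 1 else -1) * (f (btgt (dshift b)) - f (bsrc (dshift b))).
    case: b => [[u v] []]; rewrite /bd2 /dshift /bsrc /btgt /padd /= subrK addr0; ring.
  rewrite bdE => /eqP; rewrite mulf_eq0 => /orP[|]; first by case: ifP.
  by rewrite subr_eq0 => /eqP; case: E => -[-> ->].
have all0 i : (i < size g)%N -> f (nth pt0 g i) = f (nth pt0 g 0).
  elim: i => // i IH ig; have ig' := ltnW ig.
  by rewrite -(IH ig') (step i ig') /cnext modn_small.
by move=> a a' /(nthP pt0)[i ig <-] /(nthP pt0)[j jg <-]; rewrite !all0.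
Qed.

(** The unit flow along an open path from [v] to [v0], built bond by bond; [e] is the sign with
    which the path traverses [b0]. *)
Lemma interior_chain v0 v : v0 \in I -> v \in I -> exists w : bond -> int,
  (forall b, b \notin Eint I -> w b = 0) /\
  forall x, div w x = (x == v)%:R - (x == v0)%:R.
Proof.
move=> v0I vI; case: hI => _ [_ [comp _]].
have [s [sp <-]] := (comp v v0 vI).1 v0I.
elim: s v vI sp => [|u s IH] v vI /=.
  by move=> _; exists (fun=> 0); split=> // x; rewrite /div !(subrr, addr0).
move=> /andP[vu us]; have uI' : u \in I by apply/(comp v u vI); exists [:: u]; rewrite /= vu.
have [w [w0 dw]] := IH u uI' us; case/andP: vu => vu _.
pose b0 := ubond v u; pose e : int := if bsrc b0 == v then 1 else -1.
have b0E : b0 \in Eint I.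
  by rewrite mem_Eint; case: (zends_ubond vu) => -[-> ->]; rewrite uI' vI.
exists (fun b => (b == b0)%:R * e + w b); split.
  by move=> b bE; rewrite w0 // addr0; case: eqP bE => [->|_ _]; rewrite ?b0E // mul0r.
move=> x; have uE := Eint_uniq uI.
have -> : div (fun b => (b == b0)%:R * e + w b) x = inc x b0 * e + div w x.
  rewrite -(@sum_inc (Eint I)) // => [|b bE].
    rewrite -(@sum_inc (Eint I) w) //; under eq_bigr do rewrite mulrDr.
    rewrite big_split /=; congr (_ + _).
    under eq_bigr do rewrite mulrCA.
    by rewrite (@sum_indicator _ _ _ _ (fun b => inc x b * e)) // b0E.
  by rewrite w0 // addr0; case: eqP bE => [->|_ _]; rewrite ?b0E // mul0r.
rewrite dw; have vu' : (u == v) = false.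
  by apply: contraTF vu => /eqP ->; rewrite /nn; lia.
rewrite /inc /e; case: (zends_ubond vu) => -[-> ->]; rewrite ?eqxx ?vu'; ring.
Qed.

Lemma uniq_contour_bonds : uniq (zip zs ys).
Proof.
have [sz [sy hb]] := hz; have [_ [_ ug]] := hg.
apply: (@map_uniq _ _ (fun zy => dual_dbond zy.1 zy.2)).
have -> : [seq dual_dbond zy.1 zy.2 | zy <- zip zs ys] =
    [seq (dbl_dual aa.1, dbl_dual aa.2)
       | aa <- [seq (nth pt0 g i, cnext g i) | i <- iota 0 (size g)]].
  have szip : size (zip zs ys) = size g by rewrite size_zip sz sy minnn.
  apply: (@eq_from_nth _ (pt0, pt0)); first by rewrite !size_map size_iota.
  move=> i; rewrite size_map szip => ig.
  rewrite (nth_map (pt0, pt0)) ?szip // nth_zip ?sz ?sy //= (hb i ig).2.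
  rewrite (nth_map (pt0, pt0)) ?size_map ?size_iota //.
  by rewrite (nth_map 0%N) ?size_iota // nth_iota.
rewrite map_inj_uniq // => -[[a b] [c d]] [[a' b'] [c' d']] [] h1 h2 h3 h4.
have [-> -> -> ->] : [/\ a = a', b = b', c = c' & d = d'] by split; lia.
by [].
Qed.

(** Both orientations of each interior bond and the directed contour bonds are distinct among the
    four directed bonds leaving each vertex of [I]. *)
Lemma handshake : (2 * size (Eint I) + size g <= 4 * size I)%N.
Proof.
have [sz [sy hb]] := hz.
pose dirs : seq pt := [:: (1, 0); (-1, 0); (0, 1); (0, -1)].
pose D := [seq (v, padd v d) | v <- I, d <- dirs].
have memD v w : v \in I -> nn v w -> (v, w) \in D.
  move=> vI /nn_cases h; apply/allpairsP => /=.
  have [d [dd ->]] : exists d, d \in dirs /\ w = padd v d; last by exists (v, d).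
  by case: h => ->; [exists (1, 0)|exists (-1, 0)|exists (0, 1)|exists (0, -1)];
    rewrite /padd /= addr0.
pose sw (b : bond) := (btgt b, bsrc b).
pose L := zip zs ys ++ [seq zends b | b <- Eint I] ++ [seq sw b | b <- Eint I].
have zendsI : injective zends.
  by apply: (can_inj (g := fun e => ubond e.1 e.2)) => b; apply: ubond_zends.
have swI : injective sw.
  by apply: (can_inj (g := fun e => ubond e.2 e.1)) => b; apply: ubond_zends.
have out v w : (v, w) \in zip zs ys -> w \notin I.
  move=> /(nthP (pt0, pt0))[i]; rewrite size_zip sz sy minnn => ig.
  by rewrite nth_zip ?sz ?sy // => -[_ <-]; apply: contour_outer.
have uL : uniq L.
  rewrite !cat_uniq uniq_contour_bonds !map_inj_uniq // Eint_uniq // andbT /=.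
  apply/andP; split.
    apply/hasPn => -[v w]; rewrite mem_cat => /orP[] /mapP[b]; rewrite mem_Eint => /andP[h1 h2];
    by move=> [-> ->]; apply/negP => /out; rewrite ?h1 ?h2.
  (* Bonds in [zends] point right or up, those in [sw] left or down. *)
  apply/hasPn => -[v w] /mapP[b _ ->]; apply/mapP => -[b' _].
  case: b b' => [[p q] []] [[p' q'] []] [];
  by rewrite /bsrc /btgt /padd /= => e1 e2 e3 e4; lia.
have subL : {subset L <= D}.
  move=> [v w]; rewrite !mem_cat => /or3P[].
  - move=> /(nthP (pt0, pt0))[i]; rewrite size_zip sz sy minnn => ig.
    rewrite nth_zip ?sz ?sy // => -[<- <-].
    by apply: memD; [apply: contour_inner|case: (hb i ig)].
  - move=> /mapP[b]; rewrite mem_Eint => /andP[h1 h2] [-> ->].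
    by apply: memD => //; apply: nn_zends.
  - move=> /mapP[b]; rewrite mem_Eint => /andP[h1 h2] [-> ->].
    by apply: memD => //; rewrite nnC; apply: nn_zends.
have := uniq_leq_size uL subL.
rewrite /L /D !size_cat !size_map size_allpairs size_zip sz sy minnn /=; lia.
Qed.

Lemma size_nonfaces : (size [seq a <- I | ~~ full I a] <= size g)%N.
Proof.
apply: uniq_leq_size; first by rewrite filter_uniq.
move=> a; rewrite mem_filter => /andP[nf aI]; apply: mixed_contour => //.
by rewrite /= aI.
Qed.

(** The identified outer vertex [None] is chosen as the root; deleting it grounds everything outside
    [I]. *)
Lemma det_GwE {R : realFieldType} (c : bond -> R) :
  det_Gw zs ys I c = (size I).+1%:R * \det (lapmx (EG zs ys I) c I).
Proof.
set es := EG zs ys I; set vs := Gw_vertices zs ys I.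
have memv b : b \in es -> ((wends I b).1 \in vs) && ((wends I b).2 \in vs).
  move=> bE; have h x : x \in [:: (wends I b).1; (wends I b).2] -> x \in vs.
    by move=> hx; rewrite mem_undup; apply/flattenP; eexists; [apply/map_f/bE|].
  by rewrite !h // !inE eqxx ?orbT.
have pvs : perm_eq vs (None :: map Some I).
  apply: uniq_perm; first exact: undup_uniq.
    rewrite /= map_inj_uniq ?uI ?andbT; last by move=> ? ? [].
    by apply/mapP => -[].
  move=> x; rewrite inE; apply/idP/idP.
    rewrite mem_undup => /flattenP[s /mapP[b _ ->]].
    by rewrite !inE /wends /= /wv => /orP[] /eqP ->; case: ifP => h; rewrite ?map_f ?orbT.
  move=> /orP[/eqP ->|/mapP[v vI ->]].
    have i0 : (0 < size g)%N := hg.1.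
    have bE := Egamma_nth i0.
    have /memv : ubond (z 0) (y 0) \in es by rewrite mem_undup mem_cat bE orbT.
    have [nn_zy _] := hz.2.2 0%N i0.
    rewrite /wends /wv; case: (zends_ubond nn_zy) => -[-> ->] /=;
    by rewrite (negbTE (contour_outer i0)) => /andP[].
  have /memv : (v, true) \in es by rewrite mem_EG /bsrc /= vI.
  by rewrite /wends /wv /bsrc /= vI => /andP[].
rewrite /det_Gw (det_zero_sumE _ _ (undup_uniq _) memv pvs).
rewrite (perm_size pvs) /= det_mxL_map size_map; congr (_ * \det _).
apply: eq_mxL => u w uIn wIn; apply: eq_bigr => b _.
have SE v x : v \in I -> (Some v == wv I x) = (v == x).
  move=> vI; rewrite /wv; case: ifP => // xI.
  by apply/esym; apply: contraFF xI => /eqP <-.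
by rewrite /wends /zends /= !SE.
Qed.

End Contour.

(** * Dual configuration and determinants for a q-contour *)

Section QContour.
Context {R : rcfType}.
Variables (g zs ys I : seq pt) (q : R) (c : bond -> R).
Hypothesis hg : dual_closed_path g.
Hypothesis hz : primal_bonds g zs ys.
Hypothesis hI : is_interior zs ys I.
Hypothesis q1 : 1 < q.
Hypothesis c_cases : forall b, c b = 1 \/ c b = q.
Hypothesis c_out : forall b, b \notin Eint I -> c b = 1.
Hypothesis qc : is_qcontour q g zs ys I c.

(* The dual configuration, shifted by (-1/2, -1/2) and completed by 1 *)
Definition dual_conf (b : bond) : R :=
  if [&& b \in Eint I, dunshift b \in Eint I & c (dunshift b) == 1] then q else 1.

Let uI : uniq I := hI.1.
Let I0 : (0 < size I)%N := hI.2.1.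
Let q0 : 0 < q. Proof. exact: lt_trans ltr01 q1. Qed.
Let qn1 : q != 1. Proof. by rewrite gt_eqF. Qed.
Let c0 b : 0 < c b. Proof. by case: (c_cases b) => ->. Qed.
Let c0' b : 0 < dual_conf b. Proof. by rewrite /dual_conf; case: ifP. Qed.

(** A contour bond with both ends inside would be a face of a plaquette on gamma, and its
    conductance would be both 1 and [q]. *)
Lemma qcontour_disjoint b : b \in Egamma zs ys -> b \notin Eint I.
Proof.
move=> bE; apply/negP => bI; case/andP: qc => /allP/(_ b bE) /eqP cb1.
have [i ig be] := EgammaP hz bE.
move=> /allP/(_ _ (mem_nth pt0 ig))/allP/(_ b); rewrite bI cb1 eq_sym (negbTE qn1).
suff -> : b \in plaq_faces (nth pt0 g i) by move/(_ isT).
have [nn_zy /(dual_dbond_ends nn_zy) E] := hz.2.2 i ig.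
by rewrite mem_plaq_faces be; case: E => E; rewrite (dshift_star_cases _ E) eqxx ?orbT.
Qed.

(** If such a plaquette were not full it would lie on gamma, and its interior sides would have
    conductance [q]. *)
Lemma qcontour_full a b : b \in Eint I -> c b = 1 -> b \in plaq_faces a -> full I a.
Proof.
move=> bE cb ba; apply: contraT => nf.
have ag : a \in g.
  apply: (mixed_contour hg hz hI qcontour_disjoint nf).
  move: bE; rewrite mem_Eint => /andP[bs bt]; apply/hasP.
  case: a ba {nf} => x y; rewrite !inE => /or4P[] /eqP bE; move: bs bt;
    rewrite bE /bsrc /btgt /padd /= ?addr0 => bs bt.
  - by exists (x, y); rewrite ?mem_head.
  - by exists (x, y + 1); rewrite // !inE eqxx ?orbT.
  - by exists (x, y); rewrite ?mem_head.
  - by exists (x + 1, y); rewrite // !inE eqxx ?orbT.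
have /andP[_ /allP/(_ a ag)/allP/(_ b ba)] := qc.
by rewrite bE cb eq_sym (negbTE qn1).
Qed.

(** If [c b = 1], both plaquettes beside [b] are full, so [dshift b] is again an interior bond and
    has the value [q]. Hence the dual configuration determines [c] on the interior bonds. *)
Lemma dual_conf_dshift b : b \in Eint I -> dual_conf (dshift b) = q / c b.
Proof.
move=> bE; rewrite /dual_conf dshiftK bE; case: (c_cases b) => cb.
  rewrite cb eqxx invr1 mulr1.
  suff -> : dshift b \in Eint I by [].
  have h x : dshift b \in star x -> x \in I.
    by rewrite -mem_plaq_faces => /(qcontour_full bE cb) /andP[].
  by rewrite mem_Eint !h // mem_star eqxx ?orbT.
by rewrite cb (negbTE qn1) !andbF divff // gt_eqF.
Qed.

Lemma dual_conf_neq1 b : dual_conf b != 1 -> dunshift b \in Eint I /\ c (dunshift b) = 1.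
Proof. by rewrite /dual_conf; case: and3P => [[_ h /eqP]|]; rewrite ?eqxx. Qed.

(** Bonds that are not shifted duals of interior bonds carry 1, so only the factors [q / c b]
    remain. This will show that the numbers of [q] in the two configurations add up to the number of
    interior bonds. *)
Lemma prod_dual_conf :
  (\prod_(b <- Eint I) dual_conf b) * (\prod_(b <- Eint I) c b) = q ^+ size (Eint I).
Proof.
have uE := Eint_uniq uI.
have -> : \prod_(b <- Eint I) dual_conf b = \prod_(b <- map dshift (Eint I)) dual_conf b.
  apply: eq_big_supp => //; first by rewrite map_inj_uniq //; apply: can_inj dshiftK.
  move=> b nb; have [h1 h2] := dual_conf_neq1 nb.
  rewrite -[b in RHS]dunshiftK map_f //; move: nb; rewrite /dual_conf.
  by case: (b \in Eint I); rewrite ?eqxx.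
rewrite big_map -big_split /= big_seq (eq_bigr (fun=> q)); last first.
  by move=> b bE; rewrite dual_conf_dshift // divfK // gt_eqF.
by rewrite -big_seq big_const_seq count_predT iter_mulr_1.
Qed.

Lemma lapmx_EG_posdef (c1 : bond -> R) :
  (forall b, 0 < c1 b) -> posdef (lapmx (EG zs ys I) c1 I).
Proof.
move=> c1p; apply: lapmx_posdef => //; apply: inc_row_free => // b.
by rewrite (mem_EG hz hI qcontour_disjoint).
Qed.

Lemma det_Gw_gt0 (c1 : bond -> R) : (forall b, 0 < c1 b) -> 0 < det_Gw zs ys I c1.
Proof.
move=> c1p; rewrite (det_GwE hg hz hI qcontour_disjoint) mulr_gt0 ?ltr0Sn //.
exact/posdef_det_gt0/lapmx_EG_posdef.
Qed.

(** On dual bonds [1 / c] is the dual configuration divided by [q]; the scalar later yields one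
    power of [q] per plaquette. All four bonds at a full plaquette are shifted duals, so no term is
    missing. *)
Lemma lap_dual_conf : mxL (faces I) (faces I)
    (lap_entry (Eint I) (fun b => zends (dshift b)) (fun b => (c b)^-1)) =
  q^-1 *: lapmx (EG zs ys I) dual_conf (faces I).
Proof.
have -> : q^-1 *: lapmx (EG zs ys I) dual_conf (faces I) =
  mxL (faces I) (faces I) (fun a a' => q^-1 * lap_entry (EG zs ys I) zends dual_conf a a').
  by apply/matrixP => i j; rewrite !mxE.
apply: eq_mxL => a a'; rewrite !mem_faces => fa _.
pose G b : R := q^-1 * (dual_conf b * (inc a b * inc a' b)).
rewrite /lap_entry mulr_sumr big_seq (eq_bigr (fun b => G (dshift b))); last first.
  move=> b bE; rewrite /G dual_conf_dshift // !mulrA mulVf ?mul1r // gt_eqF //.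
rewrite -big_seq -(big_map dshift xpredT G); apply: eq_big_supp.
- by rewrite map_inj_uniq ?Eint_uniq //; apply: can_inj dshiftK.
- exact: undup_uniq.
move=> b; rewrite /G => nG; have bs : b \in star a.
  by apply: contraNT nG => /(@inc_star R) ->; rewrite mul0r !mulr0.
have -> : b \in map dshift (Eint I) by rewrite -[b]dunshiftK map_f // (full_star fa).
rewrite (mem_EG hz hI qcontour_disjoint); have aI : a \in I by case/andP: fa.
by move: bs; rewrite mem_star => /orP[] /eqP <-; rewrite aI ?orbT.
Qed.

(** A bond at [a] with value [q] would be dual to an interior bond of conductance 1 on the plaquette
    [a], which would then be full. *)
Lemma lap_diag_nonface a : a \in I -> ~~ full I a ->
  lap_entry (EG zs ys I) zends dual_conf a a = 4.
Proof.
move=> aI nf; rewrite /lap_entry.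
rewrite (@eq_big_supp _ _ _ _ _ (star a)) ?undup_uniq ?star_uniq //; last first.
  move=> b nb; have bs : b \in star a.
    by apply: contraNT nb; rewrite /zends /= => /(@inc_star R); rewrite /inc => ->;
      rewrite mul0r mulr0.
  rewrite bs (mem_EG hz hI qcontour_disjoint).
  by move: bs; rewrite mem_star => /orP[] /eqP <-; rewrite aI ?orbT.
have d1 b : b \in star a -> dual_conf b = 1.
  move=> bs; apply/eqP; apply: contraNT nf => /dual_conf_neq1 [h1 h2].
  by apply: (qcontour_full h1 h2); rewrite mem_plaq_faces dunshiftK.
rewrite big_seq (eq_bigr (fun=> 1)) => [|b bs]; first by rewrite -big_seq /= !big_cons big_nil; ring.
rewrite d1 // mul1r /zends /=; move: bs; rewrite mem_star.
have ne : (bsrc b == btgt b) = false.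
  by case: (b) => [[x y] []]; rewrite /bsrc /btgt /padd -!pair_eqE /pair_eq /=; lia.
by move=> /orP[] /eqP ->; rewrite ?(eq_sym (btgt b) (bsrc b)) !eqxx !ne /=; ring.
Qed.

(* Duality turns the free determinant of [c] into the Dirichlet determinant of the dual
   configuration on the plaquettes; Fischer's inequality restores the other vertices of
   the interior, at the price of a factor 4 each. *)
Lemma qcontour_det_le :
  (size (Eint I) + 1 = size I + size (faces I))%N /\
  (\prod_(b <- Eint I) c b) * det_Gw zs ys I dual_conf <=
    4 ^+ size g * q ^+ size (faces I) * det_Gw zs ys I c.
Proof.
have disj := qcontour_disjoint.
have gp := hg.1; pose v0 := nth pt0 zs 0.
have v0I : v0 \in I := contour_inner hz hI gp.
pose w := nth pt0 ys 0; have wI : w \notin I := contour_outer hz hI disj gp.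
pose I' := rem v0 I; have pI : perm_eq I (v0 :: I') := perm_to_rem v0I.
have [e injA dual] := planar_duality uI I0 (mixed_contour hg hz hI disj)
  (contour_const hz disj) pI (fun v vI => interior_chain hI v0I vI) R.
have sI : size I = (size I').+1 by rewrite (perm_size pI).
split; first by rewrite -e sI addn1 addSn.
rewrite !(det_GwE hg hz hI disj) mulrCA [leRHS]mulrCA ler_pM2l ?ltr0Sn //.
pose b0 := ubond v0 w; have [nn0 _] := hz.2.2 0%N gp.
have b0E : b0 \in Egamma zs ys := Egamma_nth hz gp.
have uI'' : uniq (v0 :: I') by rewrite -(perm_uniq pI).
(* The bond [b0] joins the root to the outside and has conductance 1, since it is on the contour. *)
have step1 : \det (lapmx (Eint I) c I') <= \det (lapmx (EG zs ys I) c I).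
  rewrite /lapmx (det_mxL_perm _ pI) -/(lapmx _ _ _) -/(lapmx _ _ (v0 :: I')).
  apply: (@det_lapmx_free _ _ _ (Egamma zs ys) _ _ _ w b0) => //.
  - exact: perm_EG.
  - exact: (posdef_mxL_perm pI (lapmx_EG_posdef c0)).
  - exact: lapmx_posdef.
  - by case/andP: uI''.
  - by rewrite -(perm_mem pI).
  - by rewrite mem_undup mem_cat b0E orbT.
  - by apply: c_out; apply: disj.
  - exact: zends_ubond nn0.
have := dual c (fun b => lt0r_neq0 (c0 b)); rewrite lap_dual_conf detZ => step2.
have pF : perm_eq I ([seq a <- I | ~~ full I a] ++ faces I).
  by rewrite perm_sym perm_catC; apply/permPl/(perm_filterC (full I) I).
have [pdF step3] := det_mxL_fischer (posdef_mxL_perm pF (lapmx_EG_posdef c0')).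
rewrite -(det_mxL_perm _ pF) -/(lapmx _ _ _) -/(lapmx _ _ (faces I)) in step3.
have dF := posdef_det_gt0 pdF; rewrite -/(lapmx _ _ (faces I)) in dF.
have {}step3 : \det (lapmx (EG zs ys I) dual_conf I) <=
    4 ^+ size g * \det (lapmx (EG zs ys I) dual_conf (faces I)).
  apply: le_trans step3 _; rewrite ler_pM2r //.
  rewrite big_seq (eq_bigr (fun=> 4)) => [|a]; last first.
    by rewrite mem_filter => /andP[nf aI]; rewrite lap_diag_nonface.
  rewrite -big_seq big_const_seq count_predT iter_mulr_1 ler_weXn2l ?ler1n //.
  exact: size_nonfaces hg hz hI disj.
have P0 : 0 < \prod_(b <- Eint I) c b by apply: prodr_gt0 => b _.
apply: le_trans (_ : _ <= \prod_(b <- Eint I) c b * (4 ^+ size g *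
  \det (lapmx (EG zs ys I) dual_conf (faces I)))) _; first by rewrite ler_pM2l.
rewrite [\det (lapmx (Eint I) c I')]step2 in step1.
set qf := q ^+ size (faces I); have qf0 : 0 < qf by rewrite exprn_gt0.
rewrite -(ler_pM2l (_ : 0 < 4 ^+ size g * qf)) ?mulr_gt0 ?exprn_gt0 // in step1.
apply: le_trans step1; rewrite exprVn -/qf le_eqVlt; apply/orP; left; apply/eqP.
by field; rewrite gt_eqF.
Qed.

End QContour.

(** * Configurations, weights and the final estimate *)

Section Configurations.
Context {R : rcfType}.
Variables (q : R) (es : seq bond).
Hypothesis ues : uniq es.

Lemma conf_nth lam (kap : {ffun 'I_(size es) -> bool}) (i : 'I_(size es)) :
  conf q es lam kap (nth bond0 es i) = if kap i then q else 1.
Proof.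
rewrite /conf; have eqi (j : 'I_(size es)) : (nth bond0 es j == nth bond0 es i) = (j == i).
  by rewrite nth_uniq ?ltn_ord.
have -> : [exists j : 'I_(size es), (nth bond0 es j == nth bond0 es i) && kap j] = kap i.
  apply/existsP/idP => [[j]|ki]; last by exists i; rewrite eqxx.
  by rewrite eqi => /andP[/eqP ->].
by case: (kap i) => //; rewrite (introT existsP) //; exists i.
Qed.

Lemma conf_out lam (kap : {ffun 'I_(size es) -> bool}) b :
  b \notin es -> conf q es lam kap b = lam b.
Proof.
move=> bes; have h (j : 'I_(size es)) : (nth bond0 es j == b) = false.
  by apply: contraNF bes => /eqP <-; rewrite mem_nth.
by rewrite /conf; do 2![case: existsP => [[j]|_]; rewrite ?h //].
Qed.

Lemma mem_nth_ord b : b \in es -> exists i : 'I_(size es), b = nth bond0 es i.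
Proof. by move=> /(nthP bond0)[i ies <-]; exists (Ordinal ies). Qed.

Lemma prod_conf lam (kap : {ffun 'I_(size es) -> bool}) :
  \prod_(b <- es) conf q es lam kap b = q ^+ #|[pred i | kap i]|.
Proof.
rewrite (big_nth bond0) big_mkord; under eq_bigr do rewrite conf_nth.
by rewrite -big_mkcond prodr_const.
Qed.

End Configurations.

(** Here [a] stands for q^(1/8), [D] and [D'] for square roots of determinants, [n] for |gamma|, [m]
    and [f] for the numbers of interior bonds and full plaquettes, and [h] for the number of bonds
    with value [q]. After clearing denominators the powers of [a] compare exactly by the hypothesis
    on [n + 4 * f]. *)
Lemma weight_exponents {R : rcfType} (a D D' : R) (n m h f : nat) :
  1 <= a -> 0 < D -> 0 < D' -> (h <= m)%N -> (n + 4 * f <= 4 + 2 * m)%N ->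
  a ^+ (4 * h) * D' <= 4 ^+ n * a ^+ (4 * f) * D ->
  a ^+ (2 * h) * D^-1 <= (4 * a^-1) ^+ n * a ^+ 4 * (a ^+ (2 * (m - h)) * D'^-1).
Proof.
move=> a1 D0 D0' hm nf le.
have a0 : 0 < a := lt_le_trans ltr01 a1.
rewrite exprMn exprVn.
rewrite ler_pdivrMr // [leRHS](_ : _ =
  (4 ^+ n * a ^+ 4 * a ^+ (2 * (m - h)) * D) / (a ^+ n * D')); last first.
  by field; rewrite !gt_eqF ?exprn_gt0.
rewrite ler_pdivlMr ?mulr_gt0 ?exprn_gt0 //.
rewrite -(ler_pM2l (exprn_gt0 (4 * h) a0)).
apply: le_trans (_ : _ <= a ^+ (2 * h + n) * (4 ^+ n * a ^+ (4 * f) * D)) _.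
  rewrite [leLHS](_ : _ = a ^+ (2 * h + n) * (a ^+ (4 * h) * D')); last by rewrite exprD; ring.
  by rewrite ler_pM2l ?exprn_gt0.
rewrite [leLHS](_ : _ = 4 ^+ n * D * a ^+ (2 * h + n + 4 * f)); last by rewrite !exprD; ring.
rewrite [leRHS](_ : _ = 4 ^+ n * D * a ^+ (4 * h + 4 + 2 * (m - h))); last by rewrite !exprD; ring.
by rewrite ler_pM2l ?mulr_gt0 ?exprn_gt0 // ler_weXn2l //; lia.
Qed.

Lemma eq_det_Gw {R : comNzRingType} zs ys I (c c' : bond -> R) :
  c =1 c' -> det_Gw zs ys I c = det_Gw zs ys I c'.
Proof.
move=> cc'; rewrite /det_Gw /det_zero_sum; congr (\det _); apply/matrixP => i j.
by rewrite !mxE; congr (_ - _); apply: eq_bigr => b _; rewrite cc'.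
Qed.

(** By injectivity the weights of the images sum to at most the partition function. *)
Lemma Pmeas_le {R : rcfType} (p q K : R) es lam detf (A : (bond -> R) -> bool)
    (Phi : {ffun 'I_(size es) -> bool} -> {ffun 'I_(size es) -> bool}) :
  0 < p < 1 -> 0 <= K ->
  {in [pred kap | A (conf q es lam kap)] &, injective Phi} ->
  (forall kap, A (conf q es lam kap) ->
     weight p q es lam detf kap <= K * weight p q es lam detf (Phi kap)) ->
  Pmeas p q es lam detf A <= K.
Proof.
move=> /andP[p0 p1] K0 injPhi leW.
have W0 kap : 0 <= weight p q es lam detf kap.
  by rewrite /weight !mulr_ge0 ?exprn_ge0 ?invr_ge0 ?sqrtr_ge0 ?subr_ge0 // ltW.
have Z0 : 0 <= \sum_kap weight p q es lam detf kap by apply: sumr_ge0.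
rewrite /Pmeas; have [->|Zn0] := eqVneq (\sum_kap weight p q es lam detf kap) 0.
  by rewrite invr0 mulr0.
rewrite ler_pdivrMr; last by rewrite lt_def Zn0.
apply: le_trans (ler_sum _ leW) _; rewrite -mulr_sumr ler_wpM2l //.
rewrite -(@big_imset _ _ _ _ _ Phi [pred kap | A (conf q es lam kap)] (weight p q es lam detf)) //=.
rewrite [leRHS](bigID [in Phi @: [pred kap | A (conf q es lam kap)]]) /=.
by rewrite lerDl sumr_ge0.
Qed.

Unset Implicit Arguments.
Set Strict Implicit.

Theorem theorem6p3 (R : rcfType) (q p : R) (g zs ys I : seq pt) :
  1 <= q ->
  0 < p < 1 -> (p / (1 - p)) ^+ 4 = q ->
  dual_closed_path g -> primal_bonds g zs ys -> is_interior zs ys I ->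
  Pmeas p q (Eint I) (fun _ => 1) (det_Gw zs ys I) (is_qcontour q g zs ys I)
    <= (4 * (Num.sqrt (Num.sqrt (Num.sqrt q)))^-1) ^+ size g * Num.sqrt q.
Proof.
move=> q1 p01 pq hg hz hI; have /andP[p0 p1] := p01.
set a := Num.sqrt (Num.sqrt (Num.sqrt q)).
have q0 : 0 <= q := le_trans ler01 q1.
have a2 : a ^+ 2 = Num.sqrt (Num.sqrt q) by rewrite sqr_sqrtr ?sqrtr_ge0.
have a4 : a ^+ 4 = Num.sqrt q by rewrite (exprM a 2 2) a2 sqr_sqrtr ?sqrtr_ge0.
have a8 : a ^+ 8 = q by rewrite (exprM a 4 2) a4 sqr_sqrtr.
have a1 : 1 <= a.
  by rewrite -(@ler_pXn2r _ 8) ?nnegrE ?sqrtr_ge0 // expr1n a8.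
have a0 : 0 < a := lt_le_trans ltr01 a1.
(* Self-duality in the form p/(1-p) = q^(1/4), by comparing fourth powers. *)
have pa : p = a ^+ 2 * (1 - p).
  have p1' : 0 < 1 - p by rewrite subr_gt0.
  rewrite -[LHS](divfK (lt0r_neq0 p1')); congr (_ * _); apply/eqP.
  rewrite -(@eqrXn2 _ 4) ?exprn_ge0 ?divr_ge0 ?ltW //.
  by rewrite pq -exprM a8.
rewrite -a4; set n := size g.
have K0 : 0 <= (4 * a^-1) ^+ n * a ^+ 4.
  by rewrite mulr_ge0 ?exprn_ge0 ?mulr_ge0 ?invr_ge0 // ltW.
have uE := Eint_uniq hI.1.
move: q1; rewrite le_eqVlt => /predU1P[q1|q1].
  have ae : a = 1.
    by apply/eqP; rewrite -(@eqrXn2 _ 8) // ?expr1n ?a8 ?q1 // ltW.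
  apply: (@Pmeas_le _ _ _ _ _ _ _ _ id) => // kap _.
  rewrite ler_peMl //.
    by rewrite /weight !mulr_ge0 ?exprn_ge0 ?invr_ge0 ?sqrtr_ge0 ?subr_ge0 // ltW.
  by rewrite ae invr1 mulr1 expr1n mulr1 exprn_ege1 // ler1n.
pose cf (kap : {ffun 'I_(size (Eint I)) -> bool}) := conf q (Eint I) (fun=> 1) kap.
pose Phi (kap : {ffun 'I_(size (Eint I)) -> bool}) : {ffun 'I_(size (Eint I)) -> bool} :=
  [ffun i : 'I_(size (Eint I)) =>
    let b := dunshift (nth bond0 (Eint I) i) in (b \in Eint I) && (cf kap b == 1)].
have cf_out kap b : b \notin Eint I -> cf kap b = 1 by move=> ?; rewrite /cf conf_out.
have cf_cases kap b : cf kap b = 1 \/ cf kap b = q.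
  have [/mem_nth_ord[i ->]|/cf_out ->] := boolP (b \in Eint I); last by left.
  by rewrite /cf conf_nth //; case: (kap i); [right|left].
have cfPhi kap : cf (Phi kap) =1 dual_conf I q (cf kap).
  move=> b; rewrite /dual_conf; have [/mem_nth_ord[i ->]|bE] := boolP (b \in Eint I).
    by rewrite /cf conf_nth // ffunE.
  by rewrite cf_out.
apply: (@Pmeas_le _ _ _ _ _ _ _ _ Phi) => //.
  (* The image at [dshift b] is [q / c b], from which the value at [b] is recovered. *)
  move=> k1 k2; rewrite !inE => A1 A2 e12; apply/ffunP => i.
  have bE : nth bond0 (Eint I) i \in Eint I by rewrite mem_nth.
  have := dual_conf_dshift hg hz hI q1 (cf_cases k1) A1 bE.
  rewrite -(cfPhi k1) e12 cfPhi (dual_conf_dshift hg hz hI q1 (cf_cases k2) A2 bE).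
  have qn0 : q != 0 by rewrite gt_eqF // (lt_trans ltr01).
  move=> /(mulfI qn0)/invr_inj; rewrite /cf !conf_nth // => e.
  by case: (k1 i) (k2 i) e => -[] // e; move: q1; rewrite e ltxx.
move=> kap A; set c := cf kap; set m := size (Eint I).
have [euler le_det] := qcontour_det_le hg hz hI q1 (cf_cases kap) (cf_out kap) A.
have prod_c := prod_conf q uE (fun=> 1) kap; rewrite -/(cf kap) in prod_c.
have prod_c' := prod_conf q uE (fun=> 1) (Phi kap); rewrite -/(cf (Phi kap)) in prod_c'.
have disj := qcontour_disjoint hz q1 A.
have c_gt0 k b : 0 < cf k b.
  by case: (cf_cases k b) => ->; rewrite ?ltr01 // (lt_trans ltr01).
have hm (k : {ffun 'I_m -> bool}) : (#|[pred i | k i]| <= m)%N.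
  by rewrite -[m in (_ <= m)%N]card_ord max_card.
have hs := handshake hg hz hI disj.
have card_Phi : #|[pred i | Phi kap i]| = (m - #|[pred i | kap i]|)%N.
  have := prod_dual_conf hg hz hI q1 (cf_cases kap) A.
  under eq_bigr do rewrite -cfPhi.
  rewrite prod_c prod_c' -exprD => /eqP.
  by rewrite eq_le !ler_eXn2l // -eqn_leq => /eqP; lia.
have d0 : 0 < det_Gw zs ys I (cf kap) := det_Gw_gt0 hg hz hI q1 A (c_gt0 kap).
have d0' : 0 < det_Gw zs ys I (cf (Phi kap)) := det_Gw_gt0 hg hz hI q1 A (c_gt0 (Phi kap)).
have wE k : weight p q (Eint I) (fun=> 1) (det_Gw zs ys I) k =
   (1 - p) ^+ m * (a ^+ (2 * #|[pred i | k i]|) * (Num.sqrt (det_Gw zs ys I (cf k)))^-1).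
  rewrite /weight -/m -/(cf k) {1}pa exprMn -exprM.
  have -> : (1 - p) ^+ m = (1 - p) ^+ #|[pred i | k i]| * (1 - p) ^+ (m - #|[pred i | k i]|).
    by rewrite -exprD subnKC.
  ring.
rewrite !wE [leRHS]mulrCA ler_pM2l ?exprn_gt0 ?subr_gt0 // card_Phi.
apply: (@weight_exponents _ _ _ _ _ _ _ (size (faces I))) => //; rewrite ?sqrtr_gt0 //.
  (* Euler's formula eliminates the number of interior vertices from the handshake inequality. *)
  by move: euler hs; rewrite -/m -/n; lia.
have ea k : a ^+ (4 * k) = Num.sqrt (q ^+ k).
  by rewrite exprM a4; elim: k => [|k IH]; rewrite ?sqrtr1 // !exprS IH sqrtrM.
rewrite !ea; move: le_det; rewrite prod_c -(eq_det_Gw _ _ _ (cfPhi kap)) => le_det.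
rewrite -sqrtrM ?exprn_ge0 //; apply: le_trans (ler_wsqrtr le_det) _.
(* The square root turns 4^|gamma| into 2^|gamma|, which is then weakened to 4^|gamma|. *)
rewrite !sqrtrM ?mulr_ge0 ?exprn_ge0 // !ler_wpM2r ?sqrtr_ge0 //.
rewrite -[leRHS]ger0_norm ?exprn_ge0 // -sqrtr_sqr ler_wsqrtr // -exprM.
by rewrite ler_weXn2l ?ler1n //; lia.
Qed.
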